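(* Let $n\ge1$ be an integer, $\nu>n/2$ real, and for $\lambda\in\mathbb{R}$ put $$f_0(\lambda)=\frac{(2\nu-n)\,\Gamma(n)}{\Gamma(2\nu-n+1)\,\Gamma(2\nu)}\;\mathcal{B}\!\left(n,\frac{i\lambda-n}{2}+2\nu\right)\left(\frac{\Gamma(2\nu)}{\Gamma(n)}\right)^2\;{}_3F_2\!\left[\begin{array}{c}\frac{n+i\lambda}{2},\ n,\ \frac{n+i\lambda}{2}\\ \frac{n+i\lambda}{2}+2\nu,\ n\end{array}\bigg|\,1\right].$$ Then $$f_0(\lambda)=\frac{\left|\Gamma\!\left(2\nu-\frac{n-i\lambda}{2}\right)\right|^2}{\Gamma(2\nu-n)\,\Gamma(2\nu)}.$$
   Context: $\mathcal{B}(a,b)=\Gamma(a)\Gamma(b)/\Gamma(a+b)$ is the Beta function, and ${}_3F_2\left[\begin{array}{c}a,b,c\\ d,e\end{array}\big|x\right]=\sum_{k\ge 0}\frac{(a)_k(b)_k(c)_k}{(d)_k(e)_k}\frac{x^k}{k!}$ is the generalized hypergeometric series, with $(a)_k=a(a+1)\cdots(a+k-1)$. The function $f_0$ is the case $m=0$ of the function $f_m$ for which the generalized Berezin transform of index $m$ on the unit ball of $\mathbb{C}^n$ equals $f_m(\sqrt{-\Delta_{\mathbb{B}^n}-n^2})$, where $\Delta_{\mathbb{B}^n}$ is the Laplace-Beltrami operator of the Bergman ball. *)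

(* Defs.v *)
From HB Require Import structures.
From mathcomp Require Import all_boot all_order all_algebra.
From mathcomp Require Import all_classical all_reals all_analysis.
From mathcomp Require Import complex.

Set Implicit Arguments.
Unset Strict Implicit.
Unset Printing Implicit Defensive.

Import Order.TTheory GRing.Theory Num.Theory.
Import numFieldNormedType.Exports.

Local Open Scope classical_set_scope.
Local Open Scope complex_scope.
Local Open Scope ring_scope.

(* Euler's integral [int_0^oo t^(z-1) e^(-t) dt], for [Re z > 0], split into
   its real and imaginary parts, where for [t > 0]
   [t^(x-1 + iy) = t^(x-1) (cos (y ln t) + i sin (y ln t))]. *)
Definition Gamma_integral (R : realType) (z : R[i]) : R[i] :=
  (\int[@lebesgue_measure R]_(t in `]0%R, +oo[)
      (t `^ (complex.Re z - 1) * expR (- t) * cos (complex.Im z * ln t)))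
  +i*
  (\int[@lebesgue_measure R]_(t in `]0%R, +oo[)
      (t `^ (complex.Re z - 1) * expR (- t) * sin (complex.Im z * ln t))).

Definition pochhammer (R : realType) (a : R[i]) (k : nat) : R[i] :=
  \prod_(j < k) (a + j%:R).

(* The continuation of Euler's integral to the complex plane through
   [Gamma z = Gamma (z + k) / (z)_k].  Here [k] is the least natural number
   with [Re z + k > 0]; it is 0 when [Re z > 0], as [Num.truncn] is 0 below 1
   (negative arguments included).  The value at a pole is the junk value 0. *)
Definition Gamma (R : realType) (z : R[i]) : R[i] :=
  let k := Num.truncn (1 - complex.Re z) in
  Gamma_integral (z + k%:R) / pochhammer z k.

Definition Beta (R : realType) (a b : R[i]) : R[i] :=
  Gamma a * Gamma b / Gamma (a + b).

(* [R[i]^o] is [R[i]] with the topology of its modulus.  [limn] returns 0 on a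
   divergent sequence. *)
Definition hypergeo3F2 (R : realType) (a b c d e x : R[i]) : R[i] :=
  limn (series (fun k : nat =>
    pochhammer a k * pochhammer b k * pochhammer c k
      / (pochhammer d k * pochhammer e k) * (x ^+ k / k`!%:R) : R[i]^o)).

Definition f0 (R : realType) (n : nat) (nu lambda : R) : R[i] :=
  let N : R[i] := n%:R in
  let v : R[i] := nu%:C in
  let il : R[i] := 'i * lambda%:C in
  (2 * v - N) * Gamma N / (Gamma (2 * v - N + 1) * Gamma (2 * v))
  * Beta N ((il - N) / 2 + 2 * v)
  * (Gamma (2 * v) / Gamma N) ^+ 2
  * hypergeo3F2 ((N + il) / 2) N ((N + il) / 2)
                ((N + il) / 2 + 2 * v) N 1.

(* Main.v *)
(* The parameter [n] cancels in the [3F2], leaving the Gauss series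
   [F(c) = 2F1(s, s; c; 1)] with [s = (n + i lambda) / 2] and [c = w + s],
   [w = 2 nu].  Gauss' contiguous relation
     [c (c - 2 s) F(c) = (c - s)^2 F(c + 1)]
   and [F(c + M) --> 1] reduce its summation
     [F(w + s) = Gamma (w + s) Gamma (w - s) / Gamma (w)^2]
   to [Gamma (x + s) Gamma (x - s) / Gamma (x)^2 --> 1] along [x = w + M].
   As [2 Re s = n], this quotient equals [|Gamma (x + s)|^2] divided by
   [Gamma (x)^2 (x - s)_n], and [Gamma (x + s) / Gamma (x)] is the mean of [t^s]
   for the Gamma law of parameter [x], which concentrates around [t = x], so that
   the mean is equivalent to [x^s].  Since [n - s] is the conjugate of [s], the
   surviving factor [Gamma (w + s - n) Gamma (w - s)] is a squared modulus. *)
Require Import Defs.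
From mathcomp Require Import all_boot all_order all_algebra.
From mathcomp Require Import all_classical all_reals all_analysis.
From mathcomp Require Import measurable_realfun.
From mathcomp Require Import complex ring lra.

Import Order.TTheory GRing.Theory Num.Theory.
Import numFieldNormedType.Exports.

Local Open Scope complex_scope.
Local Open Scope ring_scope.

(** The limits in [M] and in the number [K] of terms are kept apart by working with partial sums. On
    these the contiguous relation holds up to a boundary term [c K u_K], with [u_K] the term of
    index [K]. A Raabe test on the moduli yields two facts: [K u_K] tends to 0, which removes the
    boundary terms for each fixed [M], and the moduli have bounded sums, which brings the partial
    sums at [c + M] close to 1 uniformly in [K]. Choosing [M] first and [K] second proves
    convergence and identifies the sum at once. The concentration argument takes the place of
    Stirling's formula. The functional equation gives the integer moments of [t / x] exactly, and
    since [Re s = n / 2] the test function [u^s] is bounded by [1 + u^n], a weight with such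
    moments. Every Gamma value that occurs is taken at positive real part, where it is Euler's
    integral. That [Gamma (w + s)] may be cancelled is itself read off from the limit 1 of the Gamma
    quotients. *)

Section GaussSummation.

Set Implicit Arguments.
Unset Strict Implicit.
Local Open Scope classical_set_scope.
Local Notation modc := Normc.normc.

(** * Integrals over the positive half-line *)

Definition pos_itv {R : realType} : set R := `]0, +oo[%classic.
(** The shift [k.+2] keeps the interval nondegenerate at [k = 0], where [k.+1] would give the single
    point 1. *)
Definition compact_itv {R : realType} (k : nat) : set R :=
  `[k.+2%:R^-1, k.+2%:R]%classic.

Definition pos_integrable {R : realType} (f : R -> R) : Prop :=
  (@lebesgue_measure R).-integrable pos_itv (EFin \o f).

Definition pos_int {R : realType} (f : R -> R) : R :=
  \int[@lebesgue_measure R]_(t in pos_itv) f t.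

Lemma pos_itvE (R : realType) (t : R) : pos_itv t = (0 < t) :> Prop.
Proof. by rewrite /pos_itv /= in_itv /= andbT. Qed.

Lemma pos_itv_measurable (R : realType) :
  measurable (pos_itv : set (g_sigma_algebraType R.-ocitv.-measurable)).
Proof. exact: measurable_itv. Qed.

Lemma eq_pos_int (R : realType) (f g : R -> R) :
  (forall t : R, 0 < t -> f t = g t) -> pos_int f = pos_int g.
Proof.
by move=> fg; apply: eq_Rintegral => t; rewrite inE pos_itvE => /fg.
Qed.

Lemma pos_intD (R : realType) (f g : R -> R) :
  pos_integrable f -> pos_integrable g ->
  pos_int (fun t => f t + g t) = pos_int f + pos_int g.
Proof. by move=> itf itg; rewrite -RintegralD//; exact: pos_itv_measurable. Qed.

Lemma pos_intB (R : realType) (f g : R -> R) :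
  pos_integrable f -> pos_integrable g ->
  pos_int (fun t => f t - g t) = pos_int f - pos_int g.
Proof. by move=> itf itg; rewrite -RintegralB//; exact: pos_itv_measurable. Qed.

Lemma pos_intZ (R : realType) (c : R) (f : R -> R) :
  pos_integrable f -> pos_int (fun t => c * f t) = c * pos_int f.
Proof. by move=> itf; rewrite -RintegralZl//; exact: pos_itv_measurable. Qed.

Lemma pos_integrableD (R : realType) (f g : R -> R) :
  pos_integrable f -> pos_integrable g -> pos_integrable (fun t => f t + g t).
Proof. by move=> itf itg; exact: (integrableD (@pos_itv_measurable R) itf itg). Qed.

Lemma pos_integrableB (R : realType) (f g : R -> R) :
  pos_integrable f -> pos_integrable g -> pos_integrable (fun t => f t - g t).
Proof. by move=> itf itg; exact: (integrableB (@pos_itv_measurable R) itf itg). Qed.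

Lemma pos_integrableZ (R : realType) (c : R) (f : R -> R) :
  pos_integrable f -> pos_integrable (fun t => c * f t).
Proof. by move=> itf; exact: (integrableZl (@pos_itv_measurable R) c itf). Qed.

Lemma eq_pos_integrable (R : realType) (f g : R -> R) :
  (forall t : R, 0 < t -> f t = g t) -> pos_integrable f -> pos_integrable g.
Proof.
move=> fg; apply: (eq_integrable (@pos_itv_measurable R)) => t.
by rewrite inE pos_itvE => /fg /= ->.
Qed.

Lemma le_pos_int (R : realType) (f g : R -> R) :
  pos_integrable f -> pos_integrable g ->
  (forall t : R, 0 < t -> f t <= g t) -> pos_int f <= pos_int g.
Proof.
move=> itf itg fg; apply: le_Rintegral => //; first exact: pos_itv_measurable.
by move=> t; rewrite pos_itvE => /fg.
Qed.

Lemma compact_itv_bounds (R : realType) (k : nat) :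
  0 < k.+2%:R^-1 :> R /\ k.+2%:R^-1 < k.+2%:R :> R.
Proof.
split; first by rewrite invr_gt0 ltr0n.
by rewrite (@lt_trans _ _ 1)// ?invf_lt1 ?ltr0n// ltr1n.
Qed.

Lemma compact_itv_sub (R : realType) (k : nat) : compact_itv k `<=` @pos_itv R.
Proof.
move=> t; rewrite /compact_itv /pos_itv /= !in_itv /= andbT => /andP[kt _].
exact: lt_le_trans (compact_itv_bounds R k).1 kt.
Qed.

Lemma compact_itv_near (R : realType) (t : R) :
  0 < t -> \forall k \near \oo, compact_itv k t.
Proof.
move=> t0; near=> k.
have [ht hk] : t <= k%:R /\ t^-1 <= k%:R.
  by split; near: k; exact: nbhs_infty_ger.
rewrite /compact_itv /= in_itv /= invf_ple ?posrE ?ltr0n//.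
have kk : k%:R <= k.+2%:R :> R by rewrite ler_nat -addn2 leq_addr.
by rewrite (le_trans hk kk) (le_trans ht kk).
Unshelve. all: by end_near. Qed.

Lemma bigcup_compact_itv (R : realType) :
  \bigcup_k compact_itv k = @pos_itv R.
Proof.
apply/seteqP; split=> [t [k _]|t]; first exact: compact_itv_sub.
rewrite pos_itvE => /compact_itv_near [k _ kt].
by exists k => //; apply: kt => /=.
Qed.

Lemma compact_itv_nondecreasing (R : realType) :
  nondecreasing_seq (@compact_itv R).
Proof.
move=> m n mn; apply/subsetPset => t.
rewrite /compact_itv /= !in_itv /= => /andP[h1 h2].
rewrite (le_trans h2) ?ler_nat// andbT (le_trans _ h1)//.
by rewrite lef_pV2 ?posrE ?ltr0n// ler_nat.
Qed.

Lemma continuous_pos_measurable (R : realType) (f : R -> R) :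
  (forall t : R, 0 < t -> {for t, continuous f}) -> measurable_fun pos_itv f.
Proof.
move=> cf; have o : open (@pos_itv R) by exact: interval_open.
apply: (open_continuous_measurable_fun o) => t.
by rewrite inE pos_itvE => /cf.
Qed.

Lemma le_pos_integrable (R : realType) (f g : R -> R) :
  (forall t : R, 0 < t -> {for t, continuous f}) ->
  (forall t : R, 0 < t -> `|f t| <= g t) -> pos_integrable g -> pos_integrable f.
Proof.
move=> cf fg; have mf := continuous_pos_measurable cf.
have mEf : measurable_fun pos_itv (EFin \o f) by exact/measurable_EFinP.
apply: (le_integrable (@pos_itv_measurable R) mEf) => t; rewrite pos_itvE => t0.
by rewrite /= lee_fin; exact: le_trans (fg _ t0) (ler_norm _).
Qed.

Lemma ler_norm_pos_int (R : realType) (f g : R -> R) :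
  pos_integrable f -> pos_integrable g ->
  (forall t : R, 0 < t -> `|f t| <= g t) -> `|pos_int f| <= pos_int g.
Proof.
move=> itf itg fg; apply: le_trans (le_normr_Rintegral (@pos_itv_measurable R) itf) _.
apply: le_pos_int => //; exact: (integrable_abse itf).
Qed.

Lemma integral_compact_itv (R : realType) (f F : R -> R) (k : nat) :
  (forall t : R, 0 < t -> {for t, continuous f}) ->
  (forall t : R, 0 < t -> is_derive t 1 F (f t)) ->
  (\int[@lebesgue_measure R]_(t in compact_itv k) (f t)%:E)%E =
    (F k.+2%:R - F k.+2%:R^-1)%:E.
Proof.
move=> cf dF; have [a0 ab] := compact_itv_bounds R k.
have gt0 (t : R) : k.+2%:R^-1 <= t -> 0 < t by exact: lt_le_trans.
have cF (t : R) : 0 < t -> {for t, continuous F}.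
  move=> t0; apply: differentiable_continuous; apply/derivable1_diffP.
  by have [] := dF _ t0.
rewrite EFinB; apply: continuous_FTC2 => //.
- apply: continuous_in_subspaceT => t; rewrite inE /= in_itv /= => /andP[h _].
  exact/cf/gt0.
- split.
  + move=> t; rewrite in_itv /= => /andP[h _].
    by have [] := dF _ (gt0 _ (ltW h)).
  + exact/cvg_at_right_filter/cF.
  + exact/cvg_at_left_filter/cF/gt0/ltW.
- move=> t; rewrite in_itv /= => /andP[h _].
  by rewrite derive1E; have [_ ->] := dF _ (gt0 _ (ltW h)).
Qed.

(** Monotone convergence along the exhaustion by [compact_itv]: each partial integral is a
    difference of two values of [F], hence at most [M + M]. *)
Lemma integrable_bounded_primitive (R : realType) (f F : R -> R) (M : R) :
  (forall t : R, 0 < t -> {for t, continuous f}) ->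
  (forall t : R, 0 < t -> is_derive t 1 F (f t)) ->
  (forall t : R, 0 < t -> 0 <= f t) -> (forall t : R, 0 < t -> `|F t| <= M) ->
  pos_integrable f.
Proof.
move=> cf dF f0 FM; have mf := continuous_pos_measurable cf.
apply/integrableP; split; first exact/measurable_EFinP.
rewrite (@eq_integral _ _ _ (@lebesgue_measure R) pos_itv (EFin \o f)); last first.
  move=> t; rewrite inE pos_itvE => t0.
  by rewrite /= ger0_norm// f0.
rewrite -bigcup_compact_itv.
have fk0 (k : nat) (t : R) : compact_itv k t -> (0 <= (EFin \o f) t)%E.
  move=> /compact_itv_sub; rewrite pos_itvE => t0.
  by rewrite lee_fin f0.
have mk (k : nat) : measurable_fun (compact_itv k) (EFin \o f).
  apply/measurable_EFinP.
  exact: measurable_funS (measurable_itv _) (@compact_itv_sub R k) mf.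
have H := ge0_nondecreasing_set_cvg_integral (@compact_itv_nondecreasing R)
  (fun k => measurable_itv _) mk fk0 (mu := @lebesgue_measure R).
have le k : (\int[@lebesgue_measure R]_(x in compact_itv k) (EFin \o f) x <=
    (M + M)%:E)%E.
  rewrite (integral_compact_itv k cf dF) lee_fin.
  have [a0 ab] := compact_itv_bounds R k.
  apply: le_trans (ler_norm _) _; apply: le_trans (ler_normB _ _) _.
  by rewrite lerD// FM.
apply: le_lt_trans (ltry (M + M)).
rewrite -(cvg_lim _ H)//; apply: lime_le; last exact: nearW.
by apply/cvg_ex; eexists; exact: H.
Qed.

(** The fundamental theorem is applied on compact intervals; dominated convergence, with [|f|] as
    the dominating function, passes to the half-line. Limits of [F] along two explicit sequences
    therefore suffice. *)
Lemma Rintegral_primitive (R : realType) (f F : R -> R) (l0 l1 : R) :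
  (forall t : R, 0 < t -> {for t, continuous f}) ->
  (forall t : R, 0 < t -> is_derive t 1 F (f t)) ->
  pos_integrable f ->
  F k.+2%:R^-1 @[k --> \oo] --> l0 -> F k.+2%:R @[k --> \oo] --> l1 ->
  pos_int f = l1 - l0.
Proof.
move=> cf dF itf Fl0 Fl1; have mf := continuous_pos_measurable cf.
pose f_ k := f \_ (compact_itv k).
have mf_ k : measurable_fun pos_itv (EFin \o f_ k).
  apply/measurable_EFinP; apply: measurable_funTS.
  apply/(measurable_restrictT f); first exact: measurable_itv.
  exact: measurable_funS (measurable_itv _) (@compact_itv_sub R k) mf.
have cvf : {ae @lebesgue_measure R, forall t, pos_itv t ->
    (EFin \o f_ k) t @[k --> \oo] --> (EFin \o f) t}.
  apply: aeW => t; rewrite pos_itvE => t0.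
  apply: cvg_near_cst; near=> k; rewrite /= /f_ patchE mem_set//; near: k.
  exact: compact_itv_near.
have bf : {ae @lebesgue_measure R, forall t k, pos_itv t ->
    (`|(EFin \o f_ k) t| <= (abse \o (EFin \o f)) t)%E}.
  apply: aeW => t k _ /=; rewrite lee_fin /f_ patchE.
  by case: ifP => // _; rewrite normr0.
have mEf : measurable_fun pos_itv (EFin \o f) by exact/measurable_EFinP.
have [_ _ H] := @dominated_convergence _ _ R (@lebesgue_measure R) pos_itv
  (measurable_itv _) _ _ _ mf_ mEf cvf (integrable_abse itf) bf.
have {}H : (F k.+2%:R - F k.+2%:R^-1)%:E @[k --> \oo] -->
    (\int[@lebesgue_measure R]_(t in pos_itv) (f t)%:E)%E.
  apply: cvg_trans H; apply: near_eq_cvg; apply: nearW => k.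
  rewrite -(integral_compact_itv k cf dF).
  have {1}<- := setIidr (@compact_itv_sub R k); rewrite integral_mkcondr.
  by apply: eq_integral => t _; rewrite /= /f_ !patchE; case: ifP.
rewrite /pos_int /Rintegral -(cvg_lim _ H)//.
have {}Fl : (F k.+2%:R - F k.+2%:R^-1)%:E @[k --> \oo] --> (l1 - l0)%:E.
  by apply: cvg_EFin; [exact: nearW | apply: cvgB].
by rewrite (cvg_lim _ Fl).
Unshelve. all: by end_near. Qed.

(** * The kernel of Euler's integral *)

(* [t^x e^(-t)] for [t > 0]. *)
Definition gker {R : realType} (x t : R) : R := expR (x * ln t - t).

Lemma gker_gt0 (R : realType) (x t : R) : 0 < gker x t.
Proof. exact: expR_gt0. Qed.

Lemma gker0 (R : realType) (t : R) : gker 0 t = expR (- t).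
Proof. by rewrite /gker mul0r add0r. Qed.

Lemma gkerD (R : realType) (x y t : R) :
  gker (x + y) t = gker x t * expR (y * ln t).
Proof. by rewrite /gker -expRD mulrDl addrAC. Qed.

Lemma gkerB1 (R : realType) (x t : R) : 0 < t -> gker (x - 1) t = gker x t / t.
Proof. by move=> t0; rewrite gkerD mulN1r expRN lnK ?posrE. Qed.

Lemma gkerD_nat (R : realType) (x t : R) (k : nat) :
  0 < t -> gker (x + k%:R) t = gker x t * t ^+ k.
Proof. by move=> t0; rewrite gkerD expRM_natl lnK ?posrE. Qed.

Lemma gker_powR (R : realType) (x t : R) :
  0 < t -> t `^ x * expR (- t) = gker x t.
Proof. by move=> t0; rewrite /gker /powR gt_eqF// -expRD. Qed.

(* [y ln t - t] is maximal at [t = y]. *)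
Lemma gker_le (R : realType) (y t : R) : 0 < y -> 0 < t -> gker y t <= gker y y.
Proof.
move=> y0 t0; rewrite /gker ler_expR.
have h : ln (t / y) <= t / y - 1.
  have -> : t / y = 1 + (t / y - 1) by ring.
  apply: le_trans (le_ln1Dx _) _; last by lra.
  by rewrite ltrBrDl subrr divr_gt0.
rewrite ln_div ?posrE// in h.
have : y * (ln t - ln y) <= y * (t / y - 1) by rewrite ler_pM2l.
have -> : y * (t / y - 1) = t - y by field; rewrite gt_eqF.
lra.
Qed.

Lemma is_derive_gker (R : realType) (x t : R) :
  0 < t -> is_derive t 1 (gker x) (x * gker (x - 1) t - gker x t).
Proof.
move=> t0; have dl : is_derive t 1 (@ln R) t^-1 by exact: is_derive1_ln.
rewrite gkerB1// /gker; apply: is_derive_eq; rewrite /GRing.scale /=.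
by field; rewrite gt_eqF.
Qed.

Lemma gker_continuous (R : realType) (x t : R) :
  0 < t -> {for t, continuous (gker x)}.
Proof.
move=> t0; apply: differentiable_continuous; apply/derivable1_diffP.
by have [] := is_derive_gker x t0.
Qed.

Lemma comp_ln_continuous (R : realType) (f : R -> R) (t : R) :
  0 < t -> continuous f -> {for t, continuous (f \o @ln R)}.
Proof. by move=> t0 cf; apply: continuous_comp; [exact: continuous_ln|exact: cf]. Qed.

(* [gker (x - 1)] is dominated by the derivative of the bounded function
   [t^x / (1 + t^x)]. *)
Lemma gker_integrable (R : realType) (x : R) : 0 < x ->
  pos_integrable (gker (x - 1)).
Proof.
move=> x0.
pose F (t : R) := (1 + expR (- x * ln t))^-1.
pose f (t : R) := x / t * expR (- x * ln t) * F t ^+ 2.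
have D0 (t : R) : 0 < 1 + expR (- x * ln t) by rewrite addr_gt0// expR_gt0.
have cF (t : R) : 0 < t -> {for t, continuous F}.
  move=> t0; apply: cvgV; first by rewrite gt_eqF.
  apply: cvgD; first exact: cvg_cst.
  apply: (@comp_ln_continuous R (fun u => expR (- x * u))) => // u.
  apply: continuous_comp; last exact: continuous_expR.
  by apply: cvgM; [exact: cvg_cst|exact: cvg_id].
have cf (t : R) : 0 < t -> {for t, continuous f}.
  move=> t0; apply: cvgM; last by apply: cvgM; exact: cF.
  apply: cvgM.
    by apply: cvgM; [exact: cvg_cst|apply: cvgV; [rewrite gt_eqF|exact: cvg_id]].
  apply: (@comp_ln_continuous R (fun u => expR (- x * u))) => // u.
  apply: continuous_comp; last exact: continuous_expR.
  by apply: cvgM; [exact: cvg_cst|exact: cvg_id].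
have dF (t : R) : 0 < t -> is_derive t 1 F (f t).
  move=> t0; have dl : is_derive t 1 (@ln R) t^-1 by exact: is_derive1_ln.
  have h : 1 + expR (- x * ln t) != 0 by rewrite gt_eqF.
  rewrite /f /F; apply: is_derive_eq; rewrite /GRing.scale /=.
  by field; rewrite h gt_eqF.
have f0 (t : R) : 0 < t -> 0 <= f t.
  move=> t0; rewrite /f mulr_ge0 ?exprn_ge0 ?invr_ge0 ?ltW//.
  by rewrite mulr_gt0 ?expR_gt0 ?divr_gt0.
have F1 (t : R) : 0 < t -> `|F t| <= 1.
  move=> t0; rewrite ger0_norm ?invr_ge0 ?ltW//.
  by rewrite invf_lt1 ?ltrDl ?expR_gt0.
have itf := integrable_bounded_primitive cf dF f0 F1.
(* With [e = t^x], the bound amounts to [exp (- t) (e + 1)^2 <= 2 exp (- t) (e^2 + 1) <= 2 (gker (2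
   x) (2 x) + 1)]; the division by [x] offsets the factor [x] of [f]. *)
pose C := 2 * (gker (2 * x) (2 * x) + 1) / x.
have C0 : 0 < C by rewrite divr_gt0// mulr_gt0// addr_gt0 ?gker_gt0.
have le (t : R) : 0 < t -> gker (x - 1) t <= C * f t.
  move=> t0; set e := expR (x * ln t); have e0 : 0 < e by exact: expR_gt0.
  have eN : expR (- x * ln t) = e^-1 by rewrite mulNr expRN.
  have -> : f t = x / t * e / (e + 1) ^+ 2.
    rewrite /f /F eN; field.
    by rewrite !gt_eqF ?addr_gt0.
  have -> : gker (x - 1) t = expR (- t) * e / t.
    by rewrite gkerB1// -[x]add0r gkerD gker0.
  have -> : C * (x / t * e / (e + 1) ^+ 2) =
      (2 * (gker (2 * x) (2 * x) + 1) / (e + 1) ^+ 2) * (e / t).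
    by rewrite /C; field; rewrite !gt_eqF ?addr_gt0.
  rewrite -mulrA ler_pM2r ?divr_gt0// ler_pdivlMr ?exprn_gt0 ?addr_gt0//.
  have h1 : expR (- t) * e ^+ 2 <= gker (2 * x) (2 * x).
    rewrite -expRM_natl mulrA -gker0 -gkerD add0r; apply: gker_le => //.
    by rewrite mulr_gt0.
  have h2 : expR (- t) <= 1 by rewrite expR_le1 oppr_le0 ltW.
  have h3 : (e + 1) ^+ 2 <= 2 * (e ^+ 2 + 1) by have := sqr_ge0 (e - 1); lra.
  apply: le_trans (_ : expR (- t) * (2 * (e ^+ 2 + 1)) <= _).
    by rewrite ler_pM2l ?expR_gt0.
  lra.
apply: (@le_pos_integrable R _ (fun t => C * f t)).
- by move=> t; exact: gker_continuous.
- by move=> t t0; rewrite ger0_norm ?le// ltW// gker_gt0.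
- exact: pos_integrableZ.
Qed.

Lemma norm_le_cvg0 (R : realType) (u v : R^nat) :
  (forall k, `|u k| <= v k) -> v @ \oo --> 0 -> u @ \oo --> 0.
Proof.
move=> uv v0; apply/norm_cvg0P.
apply: (@squeeze_cvgr _ _ _ _ (cst 0) v) => //; last exact: cvg_cst.
by apply: nearW => k /=; rewrite normr_ge0 uv.
Qed.

Lemma inv_natSS_cvg0 (R : realType) : k.+2%:R^-1 @[k --> \oo] --> (0 : R).
Proof. by have := @cvg_harmonic R; rewrite -cvg_shiftS. Qed.

(** Boundary term at 0 of the integrations by parts below, where [h] is the cosine or sine
    factor. *)
Lemma gker_mul_cvg0 (R : realType) (x : R) (h : R -> R) :
  0 < x -> (forall t, `|h t| <= 1) ->
  gker x k.+2%:R^-1 * h k.+2%:R^-1 @[k --> \oo] --> 0.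
Proof.
move=> x0 h1; apply: (@norm_le_cvg0 R _ (fun k => k.+2%:R^-1 `^ x)) => [k|].
  have t0 : 0 < k.+2%:R^-1 :> R by rewrite invr_gt0 ltr0n.
  rewrite normrM (gtr0_norm (gker_gt0 _ _)) -[leRHS]mulr1 ler_pM//.
    exact/ltW/gker_gt0.
  by rewrite -gker_powR// ler_piMr ?powR_ge0// expR_le1 oppr_le0 ltW.
have /cvg_at_rightP H := powR_cvg0 x0.
apply: (H (fun k => k.+2%:R^-1)); split=> [k|]; last exact: inv_natSS_cvg0.
by rewrite invr_gt0 ltr0n.
Qed.

Lemma gker_mul_cvgy (R : realType) (x : R) (h : R -> R) :
  0 < x -> (forall t, `|h t| <= 1) ->
  gker x k.+2%:R * h k.+2%:R @[k --> \oo] --> 0.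
Proof.
(* One spare power of [t] gives the decay: [gker x t = gker (x + 1) t / t], and [C] is the maximum
   of [gker (x + 1)]. *)
move=> x0 h1; pose C := gker (x + 1) (x + 1).
apply: (@norm_le_cvg0 R _ (fun k => C * k.+2%:R^-1)) => [k|].
  have t0 : 0 < k.+2%:R :> R by rewrite ltr0n.
  rewrite normrM (gtr0_norm (gker_gt0 _ _)) -[leRHS]mulr1 ler_pM//.
    exact/ltW/gker_gt0.
  rewrite -[x in gker x _](addrK 1) gkerB1// ler_pM2r ?invr_gt0//.
  by apply: gker_le => //; rewrite addr_gt0.
rewrite -[X in _ --> X](mulr0 C); apply: cvgM; first exact: cvg_cst.
exact: inv_natSS_cvg0.
Qed.

Lemma gker_mul_integrable (R : realType) (x : R) (h : R -> R) : 0 < x ->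
  (forall t : R, 0 < t -> {for t, continuous h}) -> (forall t, `|h t| <= 1) ->
  pos_integrable (fun t => gker (x - 1) t * h t).
Proof.
move=> x0 ch h1; apply: le_pos_integrable (gker_integrable x0) => t t0.
  by apply: continuousM; [exact: gker_continuous|exact: ch].
by rewrite normrM (gtr0_norm (gker_gt0 _ _)) ler_piMr ?h1// ltW// gker_gt0.
Qed.

Lemma cos_ln_continuous (R : realType) (y t : R) :
  0 < t -> {for t, continuous (fun t => cos (y * ln t))}.
Proof.
move=> t0; apply: (@comp_ln_continuous R (fun u => cos (y * u))) => // u.
apply: continuous_comp; last exact: continuous_cos.
by apply: cvgM; [exact: cvg_cst|exact: cvg_id].
Qed.

Lemma sin_ln_continuous (R : realType) (y t : R) :
  0 < t -> {for t, continuous (fun t => sin (y * ln t))}.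
Proof.
move=> t0; apply: (@comp_ln_continuous R (fun u => sin (y * u))) => // u.
apply: continuous_comp; last exact: continuous_sin.
by apply: cvgM; [exact: cvg_cst|exact: cvg_id].
Qed.

Lemma norm_cos_le1 (R : realType) (x : R) : `|cos x| <= 1.
Proof. by rewrite ler_norml cos_geN1 cos_le1. Qed.

Lemma norm_sin_le1 (R : realType) (x : R) : `|sin x| <= 1.
Proof. by rewrite ler_norml sin_geN1 sin_le1. Qed.

(** * Functional equation of Euler's integral, in real and imaginary parts *)

Definition gammaC {R : realType} (x y : R) : R :=
  pos_int (fun t => gker (x - 1) t * cos (y * ln t)).
Definition gammaS {R : realType} (x y : R) : R :=
  pos_int (fun t => gker (x - 1) t * sin (y * ln t)).

Lemma gammaC_integrable (R : realType) (x y : R) : 0 < x ->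
  pos_integrable (fun t => gker (x - 1) t * cos (y * ln t)).
Proof.
move=> x0; apply: gker_mul_integrable => // [t|t]; first exact: cos_ln_continuous.
exact: norm_cos_le1.
Qed.

Lemma gammaS_integrable (R : realType) (x y : R) : 0 < x ->
  pos_integrable (fun t => gker (x - 1) t * sin (y * ln t)).
Proof.
move=> x0; apply: gker_mul_integrable => // [t|t]; first exact: sin_ln_continuous.
exact: norm_sin_le1.
Qed.

(** Integration by parts: the two sides differ by the integral of the derivative of
    [gker x t * cos (y * ln t)], which vanishes at both ends. With [gammaS_rec] this is
    [Gamma (z + 1) = z Gamma z] at [z = x + iy]. *)
Lemma gammaC_rec (R : realType) (x y : R) : 0 < x ->
  gammaC (x + 1) y = x * gammaC x y - y * gammaS x y.
Proof.
move=> x0; have x1 : 0 < x + 1 by rewrite addr_gt0.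
pose f (t : R) := x * (gker (x - 1) t * cos (y * ln t)) -
  y * (gker (x - 1) t * sin (y * ln t)) - gker (x + 1 - 1) t * cos (y * ln t).
have iC := gammaC_integrable y x0; have iS := gammaS_integrable y x0.
have iC1 := gammaC_integrable y x1.
have iCS := pos_integrableB (pos_integrableZ x iC) (pos_integrableZ y iS).
have -> : gammaC (x + 1) y = x * gammaC x y - y * gammaS x y - pos_int f.
  rewrite (pos_intB iCS iC1) pos_intB ?pos_intZ//; last 2 first.
  - exact: pos_integrableZ.
  - exact: pos_integrableZ.
  by rewrite /gammaC /gammaS; ring.
suff -> : pos_int f = 0 - 0 by rewrite !subr0.
apply: (@Rintegral_primitive R f (fun t => gker x t * cos (y * ln t))).
- move=> t t0.
  have cg u : {for t, continuous (gker u)} by exact: gker_continuous.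
  have cc := @cos_ln_continuous R y t t0; have cs := @sin_ln_continuous R y t t0.
  apply: cvgB; last by apply: cvgM; [exact: cg|exact: cc].
  apply: cvgB; apply: cvgM; [exact: cvg_cst| |exact: cvg_cst|].
    by apply: cvgM; [exact: cg|exact: cc].
  by apply: cvgM; [exact: cg|exact: cs].
- move=> t t0; have dl : is_derive t 1 (@ln R) t^-1 by exact: is_derive1_ln.
  have dg := is_derive_gker x t0.
  apply: is_derive_eq; rewrite /f /GRing.scale /= addrK gkerB1//.
  by field; rewrite gt_eqF.
- exact: pos_integrableB.
- apply: (@gker_mul_cvg0 R x (fun t => cos (y * ln t))) => // t.
  exact: norm_cos_le1.
- apply: (@gker_mul_cvgy R x (fun t => cos (y * ln t))) => // t.
  exact: norm_cos_le1.
Qed.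

Lemma gammaS_rec (R : realType) (x y : R) : 0 < x ->
  gammaS (x + 1) y = x * gammaS x y + y * gammaC x y.
Proof.
move=> x0; have x1 : 0 < x + 1 by rewrite addr_gt0.
pose f (t : R) := x * (gker (x - 1) t * sin (y * ln t)) +
  y * (gker (x - 1) t * cos (y * ln t)) - gker (x + 1 - 1) t * sin (y * ln t).
have iC := gammaC_integrable y x0; have iS := gammaS_integrable y x0.
have iS1 := gammaS_integrable y x1.
have iCS := pos_integrableD (pos_integrableZ x iS) (pos_integrableZ y iC).
have -> : gammaS (x + 1) y = x * gammaS x y + y * gammaC x y - pos_int f.
  rewrite (pos_intB iCS iS1) pos_intD ?pos_intZ//; last 2 first.
  - exact: pos_integrableZ.
  - exact: pos_integrableZ.
  by rewrite /gammaC /gammaS; ring.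
suff -> : pos_int f = 0 - 0 by rewrite !subr0.
apply: (@Rintegral_primitive R f (fun t => gker x t * sin (y * ln t))).
- move=> t t0.
  have cg u : {for t, continuous (gker u)} by exact: gker_continuous.
  have cc := @cos_ln_continuous R y t t0; have cs := @sin_ln_continuous R y t t0.
  apply: cvgB; last by apply: cvgM; [exact: cg|exact: cs].
  apply: cvgD; apply: cvgM; [exact: cvg_cst| |exact: cvg_cst|].
    by apply: cvgM; [exact: cg|exact: cs].
  by apply: cvgM; [exact: cg|exact: cc].
- move=> t t0; have dl : is_derive t 1 (@ln R) t^-1 by exact: is_derive1_ln.
  have dg := is_derive_gker x t0.
  apply: is_derive_eq; rewrite /f /GRing.scale /= addrK gkerB1//.
  by field; rewrite gt_eqF.
- exact: pos_integrableB.
- apply: (@gker_mul_cvg0 R x (fun t => sin (y * ln t))) => // t.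
  exact: norm_sin_le1.
- apply: (@gker_mul_cvgy R x (fun t => sin (y * ln t))) => // t.
  exact: norm_sin_le1.
Qed.

Lemma Gamma_integralE (R : realType) (z : R[i]) :
  Gamma_integral z =
    gammaC (complex.Re z) (complex.Im z) +i* gammaS (complex.Re z) (complex.Im z).
Proof.
by rewrite /Gamma_integral; congr (_ +i* _); apply: eq_pos_int => t t0;
  rewrite gker_powR.
Qed.

(** * Concentration of the Gamma law *)

(** Euler's Gamma function on the positive reals, which is also the mass that normalizes the Gamma
    law of parameter [x]. *)
Definition rgamma {R : realType} (x : R) : R := pos_int (gker (x - 1)).

Lemma gammaC0 (R : realType) (x : R) : gammaC x 0 = rgamma x.
Proof. by apply: eq_pos_int => t _; rewrite mul0r cos0 mulr1. Qed.

Lemma gammaS0 (R : realType) (x : R) : gammaS x 0 = 0.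
Proof.
rewrite -[RHS](mul0r (pos_int (fun t => gker (x - 1) t * sin (0 * ln t)))).
rewrite /gammaS /pos_int /Rintegral integral0_eq ?mulr0// => t _.
by rewrite mul0r sin0 mulr0.
Qed.

Lemma rgamma_rec (R : realType) (x : R) : 0 < x -> rgamma (x + 1) = x * rgamma x.
Proof. by move=> x0; rewrite -!gammaC0 gammaC_rec// mul0r subr0. Qed.

Lemma rgamma_gt0 (R : realType) (x : R) : 0 < x -> 0 < rgamma x.
Proof.
(* A lower bound of the integrand on [[1/2, 2]], where [|ln t| <= ln 2] and [t <= 2]. *)
move=> x0; pose c : R := expR (- (`|x - 1| * ln 2 + 2)).
have c0 : 0 < c by exact: expR_gt0.
have cle t : compact_itv 0 t -> c <= gker (x - 1) t.
  rewrite /compact_itv /= in_itv /= => /andP[h1 h2].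
  have t0 : 0 < t by apply: lt_le_trans h1.
  have l2 : `|ln t| <= ln 2.
    have l1 : ln 2^-1 <= ln t by rewrite ler_ln ?posrE ?invr_gt0.
    have l2 : ln t <= ln 2 by rewrite ler_ln ?posrE.
    by rewrite lnV ?posrE// in l1; rewrite ler_norml l1 l2.
  rewrite /c /gker ler_expR.
  have : `|(x - 1) * ln t| <= `|x - 1| * ln 2 by rewrite normrM ler_wpM2l.
  by rewrite ler_norml => /andP[+ _]; lra.
have itg := gker_integrable x0.
have hc (t : R) : 0 < t -> {for t, continuous (fun=> c : R)}.
  by move=> _; exact: cvg_cst.
have hd (t : R) : 0 < t -> is_derive t 1 (fun t => c * t) c.
  move=> _; apply: is_derive_eq; rewrite /GRing.scale /=; ring.
rewrite -lte_fin; apply: (@lt_le_trans _ _ (c * 2 - c * 2^-1)%:E).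
  by rewrite lte_fin -mulrBr mulr_gt0//; lra.
rewrite -(integral_compact_itv 0 hc hd).
rewrite /rgamma /pos_int /Rintegral fineK; last first.
  exact: (integrable_fin_num (@pos_itv_measurable R) itg).
have mg : measurable_fun pos_itv (EFin \o gker (x - 1)) by case/integrableP : itg.
apply: (@le_trans _ _
  (\int[@lebesgue_measure R]_(t in compact_itv 0) (gker (x - 1) t)%:E)%E).
  apply: ge0_le_integral.
  - exact: measurable_itv.
  - by move=> t _; rewrite lee_fin ltW.
  - exact: measurable_cst.
  - exact: measurable_funS (@pos_itv_measurable R) (@compact_itv_sub R 0) mg.
  - by move=> t ct; rewrite lee_fin cle.
apply: ge0_subset_integral.
- exact: measurable_itv.
- exact: measurable_itv.
- exact: mg.
- by move=> t _; rewrite lee_fin ltW// gker_gt0.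
- exact: compact_itv_sub.
Qed.

(** The moment of order [k] of [t / x] under the Gamma law of parameter [x], that is
    [(x)_k / x^k]. *)
Definition gmoment {R : realType} (k : nat) (x : R) : R :=
  \prod_(i < k) (1 + i%:R / x).

(** A factor [t^k] moves the parameter from [x] to [x + k], and [k] uses of the functional equation
    bring it back. *)
Lemma gker_moment (R : realType) (k : nat) (x : R) : 0 < x ->
  pos_integrable (fun t => gker (x - 1) t * (t / x) ^+ k) /\
  pos_int (fun t => gker (x - 1) t * (t / x) ^+ k) = gmoment k x * rgamma x.
Proof.
move=> x0; have xk : 0 < x + k%:R by rewrite ltr_wpDr.
have E t : 0 < t -> x ^- k * gker (x + k%:R - 1) t = gker (x - 1) t * (t / x) ^+ k.
  move=> t0; rewrite addrAC gkerD_nat// expr_div_n; ring.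
have it := gker_integrable xk.
split; first exact: eq_pos_integrable E (pos_integrableZ _ it).
rewrite -(eq_pos_int E) pos_intZ// -/(rgamma (x + k%:R)).
elim: k {xk E it} => [|k IH].
  by rewrite addr0 invr1 /gmoment big_ord0.
have xk : 0 < x + k%:R by rewrite ltr_wpDr.
rewrite -[in rgamma _]addn1 natrD addrA rgamma_rec// /gmoment big_ord_recr /=.
rewrite mulrAC -/(gmoment k x) -IH exprS.
by field; rewrite gt_eqF// expf_neq0// gt_eqF.
Qed.

Lemma cvg_inv_add_nat (R : realType) (c : R) : 0 < c ->
  (c + m%:R)^-1 @[m --> \oo] --> (0 : R).
Proof.
move=> c0; rewrite -cvg_shiftS.
apply: (@norm_le_cvg0 R _ harmonic); last exact: cvg_harmonic.
move=> m /=; have cm : 0 < c + m.+1%:R by rewrite addr_gt0 ?ltr0n.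
by rewrite gtr0_norm ?invr_gt0// lef_pV2 ?posrE ?ltr0n// lerDr ltW.
Qed.

Lemma gmoment_cvg1 (R : realType) (k : nat) (c : R) : 0 < c ->
  gmoment k (c + m%:R) @[m --> \oo] --> (1 : R).
Proof.
move=> c0; elim: k => [|k IH].
  rewrite (_ : (fun m => _) = cst 1); first exact: cvg_cst.
  by apply/funext => m; rewrite /gmoment big_ord0.
rewrite (_ : (fun m => _) =
    (fun m => gmoment k (c + m%:R) * (1 + k%:R / (c + m%:R)))); last first.
  by apply/funext => m; rewrite /gmoment big_ord_recr.
rewrite -[X in _ --> X]mulr1; apply: cvgM => //.
rewrite -[X in _ --> X]addr0; apply: cvgD; first exact: cvg_cst.
rewrite -[X in _ --> X](mulr0 k%:R); apply: cvgM; first exact: cvg_cst.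
exact: cvg_inv_add_nat.
Qed.

(** Three consecutive moments, each tending to 1 for large [x], enter with coefficients 1, -2, 1;
    this cancellation makes the weighted variance small. *)
Lemma gker_variance (R : realType) (k : nat) (x : R) : 0 < x ->
  pos_integrable (fun t => gker (x - 1) t * ((t / x - 1) ^+ 2 * (t / x) ^+ k)) /\
  pos_int (fun t => gker (x - 1) t * ((t / x - 1) ^+ 2 * (t / x) ^+ k)) =
    (gmoment k.+2 x - 2 * gmoment k.+1 x + gmoment k x) * rgamma x.
Proof.
move=> x0; have [i0 e0] := gker_moment k x0; have [i1 e1] := gker_moment k.+1 x0.
have [i2 e2] := gker_moment k.+2 x0; have i1' := pos_integrableZ 2 i1.
have i21 := pos_integrableB i2 i1'.
have E t : 0 < t -> gker (x - 1) t * (t / x) ^+ k.+2 -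
    2 * (gker (x - 1) t * (t / x) ^+ k.+1) + gker (x - 1) t * (t / x) ^+ k =
    gker (x - 1) t * ((t / x - 1) ^+ 2 * (t / x) ^+ k).
  by move=> _; rewrite !exprS; ring.
split; first exact: eq_pos_integrable E (pos_integrableD i21 i0).
rewrite -(eq_pos_int E) (pos_intD i21 i0) (pos_intB i2 i1') pos_intZ// e0 e1 e2.
ring.
Qed.

(* Chebyshev's argument: [t / x] has mean 1 and small variance under the
   normalized density [gker (x - 1)], even after weighting by [1 + (t / x)^n]. *)
Lemma gker_concentration (R : realType) (n : nat) (c : R) (phi : R -> R) :
  0 < c -> (forall u : R, 0 < u -> {for u, continuous phi}) ->
  (forall u : R, 0 < u -> `|phi u| <= 1 + u ^+ n) ->
  pos_int (fun t => gker (c + m%:R - 1) t * phi (t / (c + m%:R))) /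
    rgamma (c + m%:R) @[m --> \oo] --> phi 1.
Proof.
move=> c0 cphi bphi.
(* The sum of the variances with weights 1 and [u^n], per unit of mass. *)
pose V (x : R) := (gmoment 2 x - 2 * gmoment 1 x + gmoment 0 x) +
  (gmoment n.+2 x - 2 * gmoment n.+1 x + gmoment n x).
have V0 : V (c + m%:R) @[m --> \oo] --> (0 : R).
  have M k := gmoment_cvg1 k c0.
  rewrite -[X in _ --> X](_ : (1 - 2 * 1 + 1) + (1 - 2 * 1 + 1) = 0); last by ring.
  apply: cvgD; apply: cvgD => //; apply: cvgB => //.
    by apply: cvgM => //; exact: cvg_cst.
  by apply: cvgM => //; exact: cvg_cst.
apply/cvgrPdist_le => e e0.
have e2 : 0 < e / 2 by rewrite divr_gt0.
have /cvgrPdist_le/(_ _ e2)/nbhs_ballP[d /= d0 hd] := cphi 1 ltr01.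
(* At distance at least [d] from 1, [|phi u - phi 1| <= (1 + u^n) + 2 <= 3 (1 + u^n)], while
   [(u - 1)^2 / d^2 >= 1]. *)
pose K := 3 / d ^+ 2.
have K0 : 0 < K by rewrite divr_gt0// exprn_gt0.
have le u : 0 < u ->
    `|phi u - phi 1| <= e / 2 + K * ((u - 1) ^+ 2 * 1 + (u - 1) ^+ 2 * u ^+ n).
  move=> u0; have un0 : 0 <= u ^+ n by rewrite exprn_ge0// ltW.
  have [ud|ud] := ltP `|1 - u| d.
    rewrite distrC; apply: le_trans (hd _ ud) _; rewrite lerDl.
    by rewrite (mulr_ge0 (ltW K0))// addr_ge0// mulr_ge0// sqr_ge0.
  apply: le_trans (ler_normB _ _) _.
  have b1 := bphi _ u0; have := bphi _ ltr01; rewrite expr1n => b2.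
  have h : 1 <= (u - 1) ^+ 2 / d ^+ 2.
    rewrite ler_pdivlMr ?exprn_gt0// mul1r -[leRHS]real_normK ?num_real//.
    by rewrite distrC ler_sqr ?nnegrE// ltW.
  have : 3 * (1 + u ^+ n) <= 3 * (1 + u ^+ n) * ((u - 1) ^+ 2 / d ^+ 2).
    by rewrite ler_peMr// mulr_ge0// addr_ge0.
  have -> : 3 * (1 + u ^+ n) * ((u - 1) ^+ 2 / d ^+ 2) =
    K * ((u - 1) ^+ 2 * 1 + (u - 1) ^+ 2 * u ^+ n) by rewrite /K; ring.
  lra.
have : \forall m \near \oo, K * V (c + m%:R) <= e / 2.
  have KV : K * V (c + m%:R) @[m --> \oo] --> (0 : R).
    by rewrite -[X in _ --> X](mulr0 K); apply: cvgM => //; exact: cvg_cst.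
  by move/cvgr0_norm_le : KV => /(_ _ e2); apply: filterS => m; apply: le_trans (ler_norm _).
apply: filterS => m; set x := c + m%:R => KV.
have x0 : 0 < x by rewrite ltr_wpDr.
have G0 := rgamma_gt0 x0; have ig := gker_integrable x0.
have [v0 w0] := gker_variance 0 x0; have [vn wn] := gker_variance n x0.
have [m0 _] := gker_moment 0 x0; have [mn _] := gker_moment n x0.
have iphi : pos_integrable (fun t => gker (x - 1) t * phi (t / x)).
  apply: le_pos_integrable (pos_integrableD m0 mn) => t t0.
    apply: continuousM; first exact: gker_continuous.
    apply: continuous_comp; last by apply: cphi; rewrite divr_gt0.
    by apply: cvgM; [exact: cvg_id|exact: cvg_cst].
  rewrite normrM (gtr0_norm (gker_gt0 _ _)) -mulrDr expr0.
  by rewrite ler_pM2l ?gker_gt0// bphi// divr_gt0.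
have ip1 := pos_integrableZ (phi 1) ig.
have iB := pos_integrableB iphi ip1.
have iM := pos_integrableD (pos_integrableZ (e / 2) ig)
  (pos_integrableZ K (pos_integrableD v0 vn)).
have H := ler_norm_pos_int iB iM.
rewrite (pos_intB iphi ip1) (pos_intZ _ ig) in H.
rewrite (pos_intD (pos_integrableZ _ ig) (pos_integrableZ _ (pos_integrableD v0 vn))) in H.
rewrite (pos_intZ _ ig) (pos_intZ _ (pos_integrableD v0 vn)) (pos_intD v0 vn) w0 wn in H.
rewrite -/(rgamma x) -mulrDl -/(V x) in H.
set P := pos_int _ in H *.
rewrite distrC -(ler_pM2r G0) -[X in _ * X <= _](gtr0_norm G0) -normrM.
rewrite mulrBl divfK ?gt_eqF//.
apply: le_trans (H _) _ => [t t0|].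
  rewrite (mulrC (phi 1)) -mulrBr normrM (gtr0_norm (gker_gt0 _ _)).
  have u0 : 0 < t / x by rewrite divr_gt0.
  have := le _ u0; rewrite -(ler_pM2l (gker_gt0 (x - 1) t)) => /le_trans; apply.
  by rewrite expr0 le_eqVlt; apply/orP; left; apply/eqP; ring.
have : K * V x * rgamma x <= e / 2 * rgamma x by rewrite ler_pM2r.
lra.
Qed.

(** Putting [t = x u] splits [t^(n/2 + i tau)] into the same powers of [x] and of [u]. The modulus
    removes the phase [x^(i tau)], and concentration sends the mean of [u^(n/2 + i tau)], whose real
    and imaginary parts are [phi] and [psi], to 1. *)
Lemma gamma_modulus_cvg (R : realType) (n : nat) (tau c : R) : 0 < c ->
  (gammaC (c + m%:R + n%:R / 2) tau ^+ 2 + gammaS (c + m%:R + n%:R / 2) tau ^+ 2) /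
    (rgamma (c + m%:R) ^+ 2 * (c + m%:R) ^+ n) @[m --> \oo] --> (1 : R).
Proof.
move=> c0; pose sg : R := n%:R / 2.
pose phi (u : R) := expR (sg * ln u) * cos (tau * ln u).
pose psi (u : R) := expR (sg * ln u) * sin (tau * ln u).
have ce (u : R) : 0 < u -> {for u, continuous (fun u => expR (sg * ln u))}.
  move=> u0; apply: (@comp_ln_continuous R (fun v => expR (sg * v))) => // v.
  apply: continuous_comp; last exact: continuous_expR.
  by apply: cvgM; [exact: cvg_cst|exact: cvg_id].
have cphi (u : R) : 0 < u -> {for u, continuous phi}.
  by move=> u0; apply: cvgM; [exact: ce|exact: cos_ln_continuous].
have cpsi (u : R) : 0 < u -> {for u, continuous psi}.
  by move=> u0; apply: cvgM; [exact: ce|exact: sin_ln_continuous].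
(* Uses [v <= 1 + v^2] for [v = u^(n/2)], so that the bound is a weight with known moments. *)
have be (u h : R) : 0 < u -> `|h| <= 1 -> `|expR (sg * ln u) * h| <= 1 + u ^+ n.
  move=> u0 h1; rewrite normrM (gtr0_norm (expR_gt0 _)).
  apply: (@le_trans _ _ (expR (sg * ln u))); first by rewrite ler_piMr ?expR_ge0.
  have -> : u ^+ n = expR (sg * ln u) ^+ 2.
    rewrite -expRM_natl mulrA /sg [2 * _]mulrC divfK ?pnatr_eq0//.
    by rewrite expRM_natl lnK ?posrE.
  by have := sqr_ge0 (expR (sg * ln u) - 1); have := expR_gt0 (sg * ln u); nra.
have bphi (u : R) : 0 < u -> `|phi u| <= 1 + u ^+ n.
  by move=> u0; apply: be => //; exact: norm_cos_le1.
have bpsi (u : R) : 0 < u -> `|psi u| <= 1 + u ^+ n.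
  by move=> u0; apply: be => //; exact: norm_sin_le1.
have Lphi := gker_concentration c0 cphi bphi.
have Lpsi := gker_concentration c0 cpsi bpsi.
have phi1 : phi 1 = 1 by rewrite /phi ln1 !mulr0 expR0 cos0 mulr1.
have psi1 : psi 1 = 0 by rewrite /psi ln1 !mulr0 sin0 mulr0.
rewrite phi1 in Lphi; rewrite psi1 in Lpsi.
have L : (pos_int (fun t => gker (c + m%:R - 1) t * phi (t / (c + m%:R))) /
     rgamma (c + m%:R)) ^+ 2 +
   (pos_int (fun t => gker (c + m%:R - 1) t * psi (t / (c + m%:R))) /
     rgamma (c + m%:R)) ^+ 2 @[m --> \oo] --> (1 : R).
  rewrite -[X in _ --> X](_ : 1 * 1 + 0 * 0 = 1); last by ring.
  by apply: cvgD; apply: cvgM.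
apply: cvg_trans L; apply: near_eq_cvg; apply: nearW => m.
set x := c + m%:R; have x0 : 0 < x by rewrite ltr_wpDr.
have G0 := rgamma_gt0 x0; have ig := gker_integrable x0.
have [m0 _] := gker_moment 0 x0; have [mn _] := gker_moment n x0.
have int h : (forall u : R, 0 < u -> {for u, continuous h}) ->
    (forall u : R, 0 < u -> `|h u| <= 1 + u ^+ n) ->
    pos_integrable (fun t => gker (x - 1) t * h (t / x)).
  move=> ch bh; apply: le_pos_integrable (pos_integrableD m0 mn) => t t0.
    apply: continuousM; first exact: gker_continuous.
    apply: continuous_comp; last by apply: ch; rewrite divr_gt0.
    by apply: cvgM; [exact: cvg_id|exact: cvg_cst].
  rewrite normrM (gtr0_norm (gker_gt0 _ _)) -mulrDr expr0.
  by rewrite ler_pM2l ?gker_gt0// bh// divr_gt0.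
have iphi := int _ cphi bphi; have ipsi := int _ cpsi bpsi.
set Phi := pos_int _; set Psi := pos_int _.
set w := ln x; set E := expR (sg * w).
have lnt t : 0 < t -> ln t = w + ln (t / x).
  by move=> t0; rewrite ln_div ?posrE// /w addrC subrK.
have sh t : 0 < t -> gker (x + sg - 1) t = gker (x - 1) t * (E * expR (sg * ln (t / x))).
  by move=> t0; rewrite addrAC (gkerD _ sg) (lnt t t0) mulrDr expRD.
(* Together with [HS]: a rotation by the angle [tau ln x] and a scaling by [E = x^(n/2)]. The sum of
   squares keeps only the scaling. *)
have HC : gammaC (x + sg) tau = E * cos (tau * w) * Phi - E * sin (tau * w) * Psi.
  rewrite -(pos_intZ _ iphi) -(pos_intZ _ ipsi) -pos_intB; last 2 first.
  - exact: pos_integrableZ.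
  - exact: pos_integrableZ.
  apply: eq_pos_int => t t0; rewrite sh// (lnt t t0) mulrDr cosD /phi /psi; ring.
have HS : gammaS (x + sg) tau = E * sin (tau * w) * Phi + E * cos (tau * w) * Psi.
  rewrite -(pos_intZ _ iphi) -(pos_intZ _ ipsi) -pos_intD; last 2 first.
  - exact: pos_integrableZ.
  - exact: pos_integrableZ.
  apply: eq_pos_int => t t0; rewrite sh// (lnt t t0) mulrDr sinD /phi /psi; ring.
have xE : x ^+ n = E ^+ 2.
  rewrite -expRM_natl mulrA /sg [2 * _]mulrC divfK ?pnatr_eq0//.
  by rewrite expRM_natl lnK ?posrE.
have cs := cos2Dsin2 (tau * w).
have -> : gammaC (x + sg) tau ^+ 2 + gammaS (x + sg) tau ^+ 2 =
    E ^+ 2 * (Phi ^+ 2 + Psi ^+ 2).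
  rewrite -[RHS]mul1r -cs HC HS; ring.
have E0 : 0 < E by exact: expR_gt0.
by rewrite xE; field; rewrite !gt_eqF.
Qed.

(** * Pochhammer symbols and the complex Gamma function *)

Lemma pochhammerS (R : realType) (a : R[i]) (k : nat) :
  pochhammer a k.+1 = pochhammer a k * (a + k%:R).
Proof. by rewrite /pochhammer big_ord_recr. Qed.

Lemma pochhammer0 (R : realType) (a : R[i]) : pochhammer a 0 = 1.
Proof. by rewrite /pochhammer big_ord0. Qed.

Lemma pochhammer_recl (R : realType) (a : R[i]) (k : nat) :
  pochhammer a k.+1 = a * pochhammer (a + 1) k.
Proof.
rewrite /pochhammer big_ord_recl addr0; congr (_ * _); apply: eq_bigr => i _.
by rewrite lift0 -natr1 -addrA [1 + _]addrC.
Qed.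

Lemma Re_add_nat (R : realType) (z : R[i]) (k : nat) :
  complex.Re (z + k%:R) = complex.Re z + k%:R.
Proof. by case: z => a b; rewrite -(rmorph_nat (real_complex R)). Qed.

Lemma Im_add_nat (R : realType) (z : R[i]) (k : nat) :
  complex.Im (z + k%:R) = complex.Im z.
Proof. by case: z => a b; rewrite -(rmorph_nat (real_complex R)) /= addr0. Qed.

Lemma Re_gt0_neq0 (R : realType) (z : R[i]) : 0 < complex.Re z -> z != 0.
Proof. by case: z => a b /= a0; rewrite eq_complex /= gt_eqF. Qed.

Lemma pochhammer_neq0 (R : realType) (a : R[i]) (k : nat) :
  0 < complex.Re a -> pochhammer a k != 0.
Proof.
move=> a0; apply/prodf_neq0 => i _; apply: Re_gt0_neq0.
by rewrite Re_add_nat ltr_wpDr.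
Qed.

Lemma GammaE (R : realType) (z : R[i]) : 0 < complex.Re z ->
  Gamma z = gammaC (complex.Re z) (complex.Im z)
    +i* gammaS (complex.Re z) (complex.Im z).
Proof.
move=> z0; rewrite /Gamma (_ : Num.truncn _ = 0%N).
  by rewrite addr0 pochhammer0 divr1 Gamma_integralE.
by apply/truncn0Pn; rewrite -ltNge; lra.
Qed.

Lemma Gamma_rec (R : realType) (z : R[i]) : 0 < complex.Re z ->
  Gamma (z + 1) = z * Gamma z.
Proof.
move=> z0; rewrite !GammaE ?(Re_add_nat z 1) ?(Im_add_nat z 1) ?addr_gt0//.
rewrite gammaC_rec// gammaS_rec//; case: z z0 => a b /= _.
by apply/eqP; rewrite eq_complex /=; apply/andP; split; apply/eqP; ring.
Qed.

Lemma Gamma_add_nat (R : realType) (z : R[i]) (k : nat) : 0 < complex.Re z ->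
  Gamma (z + k%:R) = pochhammer z k * Gamma z.
Proof.
move=> z0; elim: k => [|k IH]; first by rewrite addr0 pochhammer0 mul1r.
rewrite -natr1 addrA Gamma_rec ?Re_add_nat ?ltr_wpDr// IH pochhammerS.
by rewrite mulrA [_ * pochhammer _ _]mulrC.
Qed.

Lemma Gamma_conj (R : realType) (z : R[i]) : 0 < complex.Re z ->
  Gamma (conjc z) = conjc (Gamma z).
Proof.
case: z => a b /= a0; rewrite !GammaE//=; congr (_ +i* _).
  by apply: eq_pos_int => t _; rewrite mulNr cosN.
rewrite -[RHS]mulN1r -pos_intZ; last exact: gammaS_integrable.
by apply: eq_pos_int => t _; rewrite mulNr sinN; ring.
Qed.

Lemma Gamma_real (R : realType) (x : R) : 0 < x -> Gamma x%:C = (rgamma x)%:C.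
Proof. by move=> x0; rewrite GammaE//= gammaC0 gammaS0. Qed.

Lemma cvg_real_complex (R : realType) (u : R^nat) (l : R) :
  u @ \oo --> l ->
  ((fun k => (u k)%:C) : nat -> R[i]^o) @ \oo --> (l%:C : R[i]^o).
Proof.
move=> /cvgrPdist_le ul; apply/cvgrPdist_le => e e0.
(* The radii in [R[i]^o] are positive elements of [R[i]], and positivity for this order forces them
   to be real. *)
have /complex_realP[r er] : e \is Num.real by rewrite gtr0_real.
rewrite {}er in e0 *; rewrite ltcR in e0.
apply: filterS (ul _ e0) => k h.
by rewrite -rmorphB normc_def /= expr0n addr0 sqrtr_sqr lecR.
Qed.

Lemma pochhammer_quot_cvg (R : realType) (c : R) (s : R[i]) (n : nat) : 0 < c ->
  ((fun m => pochhammer ((c + m%:R)%:C - s) n / (c + m%:R)%:C ^+ n)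
    : nat -> R[i]^o) @ \oo --> (1 : R[i]^o).
Proof.
move=> c0.
have x0 m : 0 < c + m%:R by rewrite ltr_wpDr.
elim: n => [|n IH].
  rewrite (_ : (fun m => _) = cst 1); first exact: cvg_cst.
  by apply/funext => m; rewrite pochhammer0 divr1.
rewrite (_ : (fun m => _) = (fun m =>
   (pochhammer ((c + m%:R)%:C - s) n / (c + m%:R)%:C ^+ n) *
   (1 + (n%:R - s) * ((c + m%:R)^-1)%:C) : R[i]^o)); last first.
  apply/funext => m; rewrite pochhammerS exprS.
  have h : (c + m%:R)%:C != 0 by apply: Re_gt0_neq0; exact: x0.
  rewrite fmorphV /=; move: (_ %:C) h => X X0.
  by field; rewrite X0 expf_neq0.
rewrite -[X in _ --> X](mulr1 1); apply: cvgM => //.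
rewrite -[X in _ --> X]addr0; apply: cvgD; first exact: cvg_cst.
rewrite -[X in _ --> X](mulr0 (n%:R - s)); apply: cvgM; first exact: cvg_cst.
exact: cvg_real_complex (cvg_inv_add_nat c0).
Qed.

Lemma Gamma_quot_cvg (R : realType) (n : nat) (w : R) (s : R[i]) :
  complex.Re s = n%:R / 2 -> n%:R / 2 < w ->
  ((fun m => Gamma (w%:C + s + m%:R) * Gamma (w%:C - s + m%:R) /
     Gamma (w%:C + m%:R) ^+ 2) : nat -> R[i]^o) @ \oo --> (1 : R[i]^o).
Proof.
move=> sn nw; have w0 : 0 < w by apply: le_lt_trans nw; rewrite divr_ge0.
have L1 := cvg_real_complex (gamma_modulus_cvg n (complex.Im s) w0).
have L2 := pochhammer_quot_cvg s n w0.
have L : ((fun m =>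
   ((gammaC (w + m%:R + n%:R / 2) (complex.Im s) ^+ 2 +
    gammaS (w + m%:R + n%:R / 2) (complex.Im s) ^+ 2) /
    (rgamma (w + m%:R) ^+ 2 * (w + m%:R) ^+ n))%:C *
   (pochhammer ((w + m%:R)%:C - s) n / (w + m%:R)%:C ^+ n)^-1)
   : nat -> R[i]^o) @ \oo --> (1 : R[i]^o).
  rewrite -[X in _ --> X](_ : 1%:C * 1^-1 = 1); last by rewrite invr1 mulr1.
  have L3 := cvgV (oner_neq0 _) L2.
  exact: (cvgM L1 (L3 _)).
apply: cvg_trans L; apply: near_eq_cvg; apply: nearW => m.
set x := w + m%:R.
have x0 : 0 < x by rewrite ltr_wpDr.
have -> : w%:C + s + m%:R = x%:C + s.
  by rewrite /x rmorphD rmorph_nat addrAC.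
have -> : w%:C - s + m%:R = x%:C - s.
  by rewrite /x rmorphD rmorph_nat addrAC.
have -> : w%:C + m%:R = x%:C by rewrite /x rmorphD rmorph_nat.
rewrite Gamma_real//.
have ReB : 0 < complex.Re (x%:C - s).
  rewrite raddfB /= sn subr_gt0; apply: lt_le_trans nw _.
  by rewrite /x lerDl.
have ReD : 0 < complex.Re (x%:C + s).
  by rewrite raddfD /= sn ltr_wpDr// divr_ge0.
(* Since [2 Re s = n], the point [x - s + n] is the conjugate of [x + s]. *)
have E : pochhammer (x%:C - s) n * Gamma (x%:C - s) = conjc (Gamma (x%:C + s)).
  rewrite -Gamma_conj// -Gamma_add_nat//; congr Gamma.
  apply/eqP; rewrite eq_complex Re_add_nat Im_add_nat.
  case: s sn {ReB ReD L1 L2} => a b /= ->.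
  by apply/andP; split; apply/eqP; [field|ring].
have G2 : Gamma (x%:C + s) * conjc (Gamma (x%:C + s)) =
  (gammaC (x + n%:R / 2) (complex.Im s) ^+ 2 +
    gammaS (x + n%:R / 2) (complex.Im s) ^+ 2)%:C.
  rewrite -sqr_normc -add_Re2_Im2 GammaE//=; case: (s) sn => a b /= ->.
  by rewrite add0r.
have p0 := pochhammer_neq0 n ReB.
rewrite rmorphM /= -G2 -E fmorphV /= rmorphM /= !rmorphXn /=.
have r0 : (rgamma x)%:C != 0 by rewrite Re_gt0_neq0//= rgamma_gt0.
have X0 : x%:C ^+ n != 0 by rewrite expf_neq0// Re_gt0_neq0.
move: (_ ^+ n) X0 => X X0.
by field; rewrite r0 X0 p0.
Qed.

(** * The Gauss series *)

(** For [v k = k U k] the hypothesis reads [v (k + 1) + eta U k <= v k]. Telescoping bounds the sums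
    of [U], and [v] is eventually nonincreasing, so it has a limit [l >= 0]. *)
Lemma raabe_test (R : realType) (U : R^nat) (eta : R) (k0 : nat) :
  (forall k, 0 <= U k) -> 0 < eta ->
  (forall k, (k0 <= k)%N -> k.+1%:R * U k.+1 <= (k%:R - eta) * U k) ->
  (k%:R * U k @[k --> \oo] --> (0 : R)) /\
  exists B, forall K, \sum_(k < K) U k <= B.
Proof.
move=> U0 e0 H; pose v (k : nat) := k%:R * U k.
have v0 k : 0 <= v k by rewrite mulr_ge0.
have vdec k : v (k + k0)%N.+1 + eta * U (k + k0)%N <= v (k + k0)%N.
  by have := H (k + k0)%N (leq_addl _ _); rewrite /v mulrBl; lra.
have tel K : eta * (\sum_(k < K) U (k + k0)%N) + v (K + k0)%N <= v k0.
  elim: K => [|K IH]; first by rewrite big_ord0 mulr0 add0r add0n.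
  by rewrite big_ord_recr /= mulrDr addSn; have := vdec K; lra.
have bK K : \sum_(k < K) U (k + k0)%N <= v k0 / eta.
  by rewrite ler_pdivlMr// mulrC; have := tel K; have := v0 (K + k0)%N; lra.
split; last first.
  exists (\sum_(k < k0) U k + v k0 / eta) => K.
  apply: (@le_trans _ _ (\sum_(k < k0 + K) U k)).
    rewrite -!(big_mkord xpredT) (big_cat_nat _ (leq_addl k0 K))//= lerDl.
    exact: sumr_ge0.
  rewrite big_split_ord /= lerD2l; under eq_bigr do rewrite addnC.
  exact: bK.
rewrite -(cvg_shiftn k0).
have vni : nonincreasing_seq (fun k => v (k + k0)%N).
  apply/nonincreasing_seqP => k; have := vdec k.
  by rewrite addSn; have := mulr_ge0 (ltW e0) (U0 (k + k0)%N); lra.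
have lb : has_lbound (range (fun k => v (k + k0)%N)).
  by exists 0 => _ [k _ <-].
have cv := nonincreasing_cvgn vni lb; set l := inf _ in cv.
have lv k : l <= v (k + k0)%N by apply: ge_inf => //; exists k.
have [l0|l0] := leP l 0.
  suff l1 : 0 <= l.
    have E : l = 0 by apply/eqP; rewrite eq_le l0 l1.
    by rewrite E in cv; exact: cv.
  by apply: lb_le_inf => [|_ [k _ <-]//]; exists (v (0 + k0)%N), 0%N.
(* A limit [l > 0] would give [U k >= l / k] for [k >= k0], and the bounded sums of [U] would make
   the harmonic series converge. *)
exfalso; apply: (@dvg_harmonic R).
apply: nondecreasing_is_cvgn.
  by apply/nondecreasing_seqP => k; rewrite seriesSr lerDl invr_ge0.
(* The factor [k0.+1] absorbs the index shift, through [k.+1 + k0 <= k0.+1 * k.+1]. *)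
exists (k0.+1%:R * (v k0 / eta) / l) => _ [K _ <-].
rewrite ler_pdivlMr// seriesEord /= mulr_suml.
apply: (@le_trans _ _ (\sum_(k < K) k0.+1%:R * U (k.+1 + k0)%N)).
  apply: ler_sum => k _; rewrite mulrC ler_pdivrMr ?ltr0n//.
  apply: le_trans (lv k.+1) _; rewrite /v mulrAC ler_wpM2r// -natrM ler_nat.
  by rewrite mulSn leq_add2l leq_pmulr.
rewrite -mulr_sumr ler_wpM2l//.
apply: le_trans (bK K.+1); rewrite big_ord_recl lerDr.
exact: U0.
Qed.

Lemma normr_modc (R : realType) (z : R[i]) : `|z| = (modc z)%:C.
Proof. by case: z. Qed.

Lemma modc_ge0 (R : realType) (z : R[i]) : 0 <= modc z.
Proof. by rewrite -lecR -normr_modc normr_ge0. Qed.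

Lemma modc_nat (R : realType) (k : nat) : modc (k%:R : R[i]) = k%:R.
Proof.
by rewrite -(rmorph_nat (real_complex R)) /Normc.normc /= expr0n addr0 sqrtr_sqr ger0_norm.
Qed.

Lemma modc_gt0 (R : realType) (z : R[i]) : (0 < modc z) = (z != 0).
Proof. by rewrite -ltcR -normr_modc normr_gt0. Qed.

Lemma modc_sqr (R : realType) (z : R[i]) :
  modc z ^+ 2 = complex.Re z ^+ 2 + complex.Im z ^+ 2.
Proof. by case: z => a b; rewrite /Normc.normc /= sqr_sqrtr// addr_ge0 ?sqr_ge0. Qed.

Lemma Re_le_modc (R : realType) (z : R[i]) : complex.Re z <= modc z.
Proof.
case: z => a b; rewrite /Normc.normc /=; apply: le_trans (ler_norm _) _.
by rewrite -sqrtr_sqr ler_wsqrtr// lerDl sqr_ge0.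
Qed.

Lemma le_modc_add_nat (R : realType) (z : R[i]) (k : nat) :
  0 <= complex.Re z -> modc z <= modc (z + k%:R).
Proof.
move=> z0; rewrite -ler_sqr ?nnegrE ?modc_ge0// !modc_sqr Re_add_nat Im_add_nat.
by rewrite lerD2r ler_sqr ?nnegrE ?addr_ge0// lerDl.
Qed.

(* The general term of the Gauss series [2F1(a, b; c; 1)]. *)
Definition gauss_term {R : realType} (a b c : R[i]) (k : nat) : R[i] :=
  pochhammer a k * pochhammer b k / (pochhammer c k * k`!%:R).

Lemma gauss_termS (R : realType) (a b c : R[i]) (k : nat) :
  gauss_term a b c k.+1 = gauss_term a b c k *
    ((a + k%:R) * (b + k%:R) / ((c + k%:R) * k.+1%:R)).
Proof.
rewrite /gauss_term !pochhammerS factS natrM !invfM.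
move: (pochhammer c k)^-1 (c + k%:R)^-1 (k`!%:R^-1) (k.+1%:R^-1) => x y z t.
ring.
Qed.

Lemma natS_neq0 (R : realType) (k : nat) : (k.+1%:R : R[i]) != 0.
Proof. by rewrite pnatr_eq0. Qed.

(** A telescoping certificate: the right-hand side is the increment of [- c k u_k] from [k] to
    [k + 1]. It rests on the fact that raising [c] by 1 multiplies [u_k] by [c / (c + k)]. *)
Lemma gauss_term_contiguous (R : realType) (a b c : R[i]) (k : nat) :
  0 < complex.Re c ->
  c * (c - a - b) * gauss_term a b c k -
    (c - a) * (c - b) * gauss_term a b (c + 1) k =
  c * (k%:R * gauss_term a b c k - k.+1%:R * gauss_term a b c k.+1).
Proof.
move=> c0; have c1 := Re_gt0_neq0 c0.
have ck : c + k%:R != 0 by apply: Re_gt0_neq0; rewrite Re_add_nat ltr_wpDr.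
have E : gauss_term a b (c + 1) k = gauss_term a b c k * (c / (c + k%:R)).
  have p0 := pochhammer_neq0 k c0.
  have p1 : pochhammer (c + 1) k = pochhammer c k * (c + k%:R) / c.
    by rewrite -pochhammerS pochhammer_recl [c * _]mulrC mulfK.
  have f0 : (k`!%:R : R[i]) != 0 by rewrite pnatr_eq0 -lt0n fact_gt0.
  rewrite /gauss_term p1; field.
  by rewrite f0 p0 ck c1.
rewrite E gauss_termS; have k1 := natS_neq0 R k.
rewrite -natr1 in k1 *; field; by rewrite k1 ck.
Qed.

Definition gauss_sum {R : realType} (a b c : R[i]) (K : nat) : R[i] :=
  \sum_(k < K) gauss_term a b c k.

Lemma gauss_sum_contiguous (R : realType) (a b c : R[i]) (K : nat) :
  0 < complex.Re c ->
  c * (c - a - b) * gauss_sum a b c K -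
    (c - a) * (c - b) * gauss_sum a b (c + 1) K =
  - (c * (K%:R * gauss_term a b c K)).
Proof.
move=> c0; elim: K => [|K IH].
  by rewrite /gauss_sum !big_ord0 !mul0r !mulr0 subrr oppr0.
rewrite /gauss_sum !big_ord_recr /= -!/(gauss_sum _ _ _ _).
have := gauss_term_contiguous a b K c0; move: IH.
move: (gauss_sum a b c K) (gauss_sum a b (c + 1) K) (gauss_term a b c K)
  (gauss_term a b (c + 1) K) (gauss_term a b c K.+1) => S S1 u u1 v IH H.
transitivity ((c * (c - a - b) * S - (c - a) * (c - b) * S1) +
  (c * (c - a - b) * u - (c - a) * (c - b) * u1)); first by ring.
rewrite IH H; ring.
Qed.

(** The factor [|s + k|^2 / |c + k|] is [k - (Re c - 2 Re s)] up to an error of order [1 / k]. Half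
    of this gap serves as [eta]; the other half absorbs the error. *)
Lemma gauss_term_ratio_le (R : realType) (s c : R[i]) :
  0 < complex.Re c -> 2 * complex.Re s < complex.Re c ->
  exists eta k0, 0 < eta /\ forall k, (k0 <= k)%N ->
    k.+1%:R * modc (gauss_term s s c k.+1) <=
      (k%:R - eta) * modc (gauss_term s s c k).
Proof.
move=> c0 sc; pose sg := complex.Re s; pose rc := complex.Re c.
pose eta := (rc - 2 * sg) / 2.
have e0 : 0 < eta by rewrite divr_gt0// subr_gt0.
(* As [Re c = 2 eta + 2 Re s], the inequality [|s + k|^2 <= (k - eta) (Re c + k)] is equivalent to
   [D <= k eta]. *)
pose D := modc s ^+ 2 + eta * rc.
have D0 : 0 <= D by rewrite addr_ge0 ?sqr_ge0// mulr_ge0// ltW.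
(* The second bound makes [k - eta] nonnegative, so that [|c + k|] may be replaced by the smaller
   [Re c + k]. *)
exists eta, (maxn (Num.bound (D / eta)) (Num.bound eta)); split => // k.
rewrite geq_max => /andP[k1 k2].
have kD : D <= k%:R * eta.
  rewrite -ler_pdivrMr//; apply: (@le_trans _ _ (Num.bound (D / eta))%:R).
    by apply/ltW/archi_boundP; rewrite divr_ge0// ltW.
  by rewrite ler_nat.
have ke : eta <= k%:R.
  apply: (@le_trans _ _ (Num.bound eta)%:R); last by rewrite ler_nat.
  by apply/ltW/archi_boundP; rewrite ltW.
rewrite gauss_termS Normc.normcM mulrCA mulrC ler_wpM2r ?modc_ge0//.
rewrite Normc.normcM Normc.normcV !Normc.normcM modc_nat.
have Mc : rc + k%:R <= modc (c + k%:R).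
  by rewrite -Re_add_nat Re_le_modc.
have Mc0 : 0 < rc + k%:R by rewrite ltr_wpDr.
have Mc1 := lt_le_trans Mc0 Mc.
have -> : k.+1%:R * (modc (s + k%:R) * modc (s + k%:R) / (modc (c + k%:R) * k.+1%:R)) =
   modc (s + k%:R) ^+ 2 / modc (c + k%:R).
  have k1' : (k.+1%:R : R) != 0 by rewrite pnatr_eq0.
  rewrite -natr1 in k1' *; field; rewrite k1' gt_eqF//.
rewrite ler_pdivrMr//; apply: (@le_trans _ _ ((k%:R - eta) * (rc + k%:R))); last first.
  by rewrite ler_wpM2l// subr_ge0.
rewrite modc_sqr Re_add_nat Im_add_nat -/sg.
have sE := modc_sqr s; rewrite -/sg in sE.
have rE : rc = 2 * eta + 2 * sg by rewrite /eta; field.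
rewrite /D sE in kD.
have k0 : 0 <= k%:R :> R by [].
move: (k%:R) kD k0 => x kD k0.
have -> : (x - eta) * (rc + x) = x ^+ 2 + 2 * sg * x + x * eta - eta * rc.
  by rewrite rE; ring.
have -> : (sg + x) ^+ 2 = x ^+ 2 + 2 * sg * x + sg ^+ 2 by ring.
lra.
Qed.

Lemma gauss_term_raabe (R : realType) (s c : R[i]) :
  0 < complex.Re c -> 2 * complex.Re s < complex.Re c ->
  (k%:R * modc (gauss_term s s c k) @[k --> \oo] --> (0 : R)) /\
  exists B, forall K, \sum_(k < K) modc (gauss_term s s c k) <= B.
Proof.
move=> c0 sc; have [eta [k0 [e0 H]]] := gauss_term_ratio_le c0 sc.
by apply: raabe_test e0 H => k; exact: modc_ge0.
Qed.

(** The first factors supply the ratio [|c| / |c + M|]; the others are compared by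
    [|c + j| <= |c + M + j|]. The index [k.+1] guarantees that a first factor exists. *)
Lemma modc_pochhammer_le (R : realType) (c : R[i]) (M k : nat) :
  0 < complex.Re c ->
  modc (pochhammer c k.+1) * modc (c + M%:R) <= modc (pochhammer (c + M%:R) k.+1) * modc c.
Proof.
move=> c0; elim: k => [|k IH].
  by rewrite !pochhammerS !pochhammer0 !addr0 !mul1r mulrC.
rewrite pochhammerS (pochhammerS _ k.+1) !Normc.normcM !(mulrAC _ (modc (_ + k.+1%:R))).
apply: ler_pM => //; rewrite ?mulr_ge0 ?modc_ge0// addrAC.
by rewrite le_modc_add_nat// Re_add_nat addr_ge0// ltW.
Qed.

(** Domination by terms with bounded sums, with a prefactor that vanishes as [M] grows: this gives
    the limit 1 at [c + M] uniformly in the number of terms. *)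
Lemma gauss_term_shift_le (R : realType) (a b c : R[i]) (M k : nat) :
  0 < complex.Re c ->
  modc (gauss_term a b (c + M%:R) k.+1) <=
    modc c / modc (c + M%:R) * modc (gauss_term a b c k.+1).
Proof.
move=> c0; have cM : 0 < complex.Re (c + M%:R) by rewrite Re_add_nat ltr_wpDr.
have H := modc_pochhammer_le M k c0.
have p0 : 0 < modc (pochhammer c k.+1) by rewrite modc_gt0 pochhammer_neq0.
have p1 : 0 < modc (pochhammer (c + M%:R) k.+1) by rewrite modc_gt0 pochhammer_neq0.
have q1 : 0 < modc (c + M%:R) by rewrite modc_gt0 Re_gt0_neq0.
rewrite /gauss_term !(Normc.normcM, Normc.normcV).
move: (modc c) (modc (c + _)) (modc (pochhammer c _)) (modc (pochhammer (c + _) _))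
  H p0 p1 q1 (modc_ge0 (pochhammer a k.+1)) (modc_ge0 (pochhammer b k.+1))
  (modc_ge0 (k.+1`!%:R : R[i])) => x y p q H p0 q0 y0.
move: (modc (pochhammer a _)) (modc (pochhammer b _)) (modc _`!%:R) => A B F A0 B0 F0.
have {}H : q^-1 <= x / y / p.
  rewrite -mulrA -invfM ler_pdivlMr ?mulr_gt0// mulrC ler_pdivrMr//.
  lra.
rewrite [leRHS](_ : _ = (A * B / F) * (x / y / p)); last by rewrite !invfM; ring.
rewrite [leLHS](_ : _ = (A * B / F) * q^-1); last by rewrite !invfM; ring.
by rewrite ler_wpM2l// !mulr_ge0// invr_ge0.
Qed.

Lemma modcD (R : realType) (x y : R[i]) : modc (x + y) <= modc x + modc y.
Proof. by rewrite -lecR rmorphD /= -!normr_modc ler_normD. Qed.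

Lemma cvg_modcP (R : realType) (u : nat -> R[i]) (l : R[i]) :
  ((u : nat -> R[i]^o) @ \oo --> (l : R[i]^o)) <->
  (modc (u k - l) @[k --> \oo] --> (0 : R)).
Proof.
split.
  move=> /cvgrPdist_le ul; apply/cvgr0Pnorm_le => e e0.
  have e0' : 0 < e%:C by rewrite ltcR.
  apply: filterS (ul _ e0') => k; rewrite distrC normr_modc lecR.
  by rewrite ger0_norm ?modc_ge0.
move=> /cvgr0Pnorm_le ul; apply/cvgrPdist_le => e e0.
have /complex_realP[r er] : e \is Num.real by rewrite gtr0_real.
rewrite {}er in e0 *; rewrite ltcR in e0.
apply: filterS (ul _ e0) => k; rewrite ger0_norm ?modc_ge0// distrC normr_modc.
by rewrite lecR.
Qed.

(** [M] is fixed first to make [g M] small, then [k] grows at a rate that may depend on [M]. The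
    restriction [0 < k] excludes the empty partial sum, which misses the leading term 1. *)
Lemma cvg_two_step (R : realType) (u : R^nat) (g : R^nat) (e : nat -> R^nat) :
  (forall k, 0 <= u k) -> (forall M k, (0 < k)%N -> u k <= g M + e M k) ->
  g @ \oo --> (0 : R) -> (forall M, e M @ \oo --> (0 : R)) -> u @ \oo --> (0 : R).
Proof.
move=> u0 H g0 E; apply/cvgr0Pnorm_le => eps e0.
have e2 : 0 < eps / 2 by rewrite divr_gt0.
have [M _ /(_ M (leqnn _)) gM] := (cvgr0Pnorm_le _).1 g0 _ e2.
have EM := (cvgr0Pnorm_le _).1 (E M) _ e2.
near=> k.
have k0 : (0 < k)%N by near: k; exact: nbhs_infty_gt.
have eM : `|e M k| <= eps / 2 by near: k; exact: EM.
rewrite ger0_norm//; apply: le_trans (H M k k0) _.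
have := ler_norm (g M); have := ler_norm (e M k).
move: gM eM => /=; lra.
Unshelve. all: by end_near. Qed.

(** The contiguous relation used [M] times; [e] collects the boundary terms, finitely many for each
    [M], which vanish in the limit by the Raabe test at each [c + m]. *)
Lemma gauss_sum_iter (R : realType) (s c : R[i]) (M : nat) :
  0 < complex.Re c -> 2 * complex.Re s < complex.Re c ->
  exists e : nat -> R[i], (modc (e k) @[k --> \oo] --> (0 : R)) /\
  forall K, gauss_sum s s c K =
    pochhammer (c - s) M ^+ 2 / (pochhammer c M * pochhammer (c - s - s) M) *
    gauss_sum s s (c + M%:R) K + e K.
Proof.
move=> c0 sc.
have RecM m : complex.Re (c + m%:R) = complex.Re c + m%:R by rewrite Re_add_nat.
have d0 : 0 < complex.Re (c - s - s) by rewrite !raddfB /=; lra.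
elim: M => [|M [e [e0 IH]]].
  exists (fun=> 0); split=> [|K]; last first.
    by rewrite /= !pochhammer0 expr1n mulr1 invr1 !mul1r !addr0.
  rewrite (_ : (fun _ => _) = cst 0); first exact: cvg_cst.
  by apply/funext => k; rewrite (modc_nat R 0).
pose A := pochhammer (c - s) M ^+ 2 / (pochhammer c M * pochhammer (c - s - s) M).
rewrite -/A in IH.
pose cM := c + M%:R.
have cM0 : 0 < complex.Re cM by rewrite RecM ltr_wpDr.
have scM : 2 * complex.Re s < complex.Re cM by rewrite RecM ltr_wpDr.
have dM0 : 0 < complex.Re (cM - s - s) by rewrite !raddfB /=; lra.
have cMn := Re_gt0_neq0 cM0; have dMn := Re_gt0_neq0 dM0.
have [T0 _] := gauss_term_raabe cM0 scM.
(* The boundary term [- cM K u_K] of the relation at [cM], divided by [cM (cM - 2 s)] and multiplied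
   by the accumulated factor [A]. *)
exists (fun K => e K - A / (cM - s - s) * (K%:R * gauss_term s s cM K)); split.
  apply: (@norm_le_cvg0 R _ (fun K => modc (e K) +
     modc (A / (cM - s - s)) * (K%:R * modc (gauss_term s s cM K)))).
    move=> K; rewrite ger0_norm ?modc_ge0//; apply: le_trans (modcD _ _) _.
    rewrite lerD2l -mulN1r !Normc.normcM modc_nat.
    have -> : modc (-1 : R[i]) = 1.
      by rewrite /Normc.normc /= oppr0 expr0n addr0 sqrtr_sqr normrN1.
    by rewrite mul1r.
  rewrite -[X in _ --> X](_ : 0 + modc (A / (cM - s - s)) * 0 = 0); last first.
    by rewrite mulr0 addr0.
  by apply: cvgD => //; apply: cvgM => //; exact: cvg_cst.
move=> K; rewrite IH.
have := gauss_sum_contiguous s s K cM0.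
have -> : cM + 1 = c + M.+1%:R by rewrite -addrA natr1.
move: (gauss_sum s s (c + M.+1%:R) K) (gauss_term s s cM K) => S1 u.
rewrite -/cM; move: (gauss_sum s s cM K) => S HS.
have ES : S = ((cM - s) * (cM - s) * S1 - cM * (K%:R * u)) / (cM * (cM - s - s)).
  apply: (mulIf (mulf_neq0 cMn dMn)); rewrite divfK ?mulf_neq0//.
  by rewrite mulrC -[LHS](subrK ((cM - s) * (cM - s) * S1)) HS addrC.
rewrite {}ES {HS} !pochhammerS.
have -> : c - s + M%:R = cM - s by rewrite /cM addrAC.
have -> : c - s - s + M%:R = cM - s - s.
  by rewrite /cM [in RHS]addrAC [in RHS](addrAC c) addrAC.
rewrite -/cM /A.
have p0 := pochhammer_neq0 M c0; have p1 := pochhammer_neq0 M d0.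
move: (pochhammer (c - s) M) (pochhammer c M) (pochhammer (c - s - s) M) p0 p1 => x y z y0 z0.
move: (cM - s - s) dMn => d dn; move: (cM) cMn => w w0.
by field; rewrite y0 z0 dn w0.
Qed.

Lemma gauss_sum_dist1 (R : realType) (s c : R[i]) (B : R) (M K : nat) :
  0 < complex.Re c ->
  (forall K, \sum_(k < K) modc (gauss_term s s c k) <= B) -> (0 < K)%N ->
  modc (gauss_sum s s (c + M%:R) K - 1) <= modc c / modc (c + M%:R) * B.
Proof.
move=> c0 HB; case: K => // K _.
rewrite /gauss_sum big_ord_recl.
have -> : gauss_term s s (c + M%:R) (@ord0 K) = 1.
  by rewrite /gauss_term /= !pochhammer0 fact0 !mul1r invr1.
rewrite [1 + _]addrC addrK.
apply: (@le_trans _ _ (\sum_(i < K) modc (gauss_term s s (c + M%:R) i.+1))).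
  under eq_bigr do rewrite lift0.
  elim: K => [|K IH]; first by rewrite !big_ord0 (modc_nat R 0).
  by rewrite !big_ord_recr /=; apply: le_trans (modcD _ _) _; rewrite lerD2r.
apply: (@le_trans _ _ (\sum_(i < K) modc c / modc (c + M%:R) * modc (gauss_term s s c i.+1))).
  by apply: ler_sum => i _; exact: gauss_term_shift_le.
rewrite -mulr_sumr ler_wpM2l ?divr_ge0 ?modc_ge0//.
apply: le_trans (HB K.+1); rewrite big_ord_recl lerDr.
exact: modc_ge0.
Qed.

Lemma gauss_sum_cvg (R : realType) (s c l : R[i]) :
  0 < complex.Re c -> 2 * complex.Re s < complex.Re c ->
  ((fun M => pochhammer (c - s) M ^+ 2 / (pochhammer c M * pochhammer (c - s - s) M))
    : nat -> R[i]^o) @ \oo --> (l : R[i]^o) ->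
  (gauss_sum s s c : nat -> R[i]^o) @ \oo --> (l : R[i]^o).
Proof.
move=> c0 sc; set A := (fun M => _) => /cvg_modcP Al; apply/cvg_modcP.
have [_ [B HB]] := gauss_term_raabe c0 sc.
have B0 : 0 <= B by have := HB 0%N; rewrite big_ord0.
have /choice[e He] M := gauss_sum_iter M c0 sc.
pose d M := modc (A M - l).
(* Here [|A M| <= d M + |l|], the product [|c| B] comes from [gauss_sum_dist1], and the last factor
   from [|c + M| >= Re c + M]. *)
pose g M := d M + (d M + modc l) * (modc c * B) * (complex.Re c + M%:R)^-1.
apply: (@cvg_two_step R _ g (fun M k => modc (e M k))).
- by move=> k; exact: modc_ge0.
- move=> M K K0; have [_ /(_ K)] := He M; rewrite -/(A M) => ->.
  have -> : A M * gauss_sum s s (c + M%:R) K + e M K - l =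
    (A M - l) + A M * (gauss_sum s s (c + M%:R) K - 1) + e M K by ring.
  apply: le_trans (modcD _ _) _; rewrite lerD2r.
  apply: le_trans (modcD _ _) _; rewrite lerD2l Normc.normcM -!mulrA.
  apply: ler_pM; rewrite ?modc_ge0//.
    by rewrite -{1}(subrK l (A M)) modcD.
  apply: le_trans (gauss_sum_dist1 M c0 HB K0) _.
  have cM0 : 0 < complex.Re c + M%:R by rewrite ltr_wpDr.
  rewrite -mulrA ler_wpM2l ?modc_ge0// mulrC ler_wpM2l//.
  have := Re_le_modc (c + M%:R); rewrite Re_add_nat => h.
  by rewrite lef_pV2// posrE// (lt_le_trans cM0).
- rewrite -[X in _ --> X](_ : 0 + (0 + modc l) * (modc c * B) * 0 = 0); last first.
    by rewrite mulr0 addr0.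
  apply: cvgD => //; apply: cvgM; last exact: cvg_inv_add_nat.
  by apply: cvgM; last exact: cvg_cst; apply: cvgD => //; exact: cvg_cst.
- by move=> M; have [] := He M.
Qed.

Lemma cvg_div_complex (R : realType) (u : nat -> R[i]) (l c : R[i]) : l != 0 ->
  ((u : nat -> R[i]^o) @ \oo --> (l : R[i]^o)) ->
  ((fun k => c * (u k)^-1) : nat -> R[i]^o) @ \oo --> (c * l^-1 : R[i]^o).
Proof. by move=> l0 ul; apply: cvgM; [exact: cvg_cst|exact: cvgV]. Qed.

(** Let [l] be the claimed limit and [q M] the Pochhammer quotient. The functional equation turns
    the Gamma quotient [P M] of [Gamma_quot_cvg] into [l / q M]; since [P M] tends to 1, [q M] tends
    to [l]. It also forces [l] to be nonzero, whence [Gamma (w + s) != 0]. *)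
Lemma pochhammer_quot_Gamma (R : realType) (n : nat) (w : R) (s : R[i]) :
  complex.Re s = n%:R / 2 -> n%:R / 2 < w ->
  [/\ Gamma (w%:C + s) != 0 &
  ((fun M => pochhammer w%:C M ^+ 2 /
     (pochhammer (w%:C + s) M * pochhammer (w%:C - s) M)) : nat -> R[i]^o) @ \oo -->
  (Gamma (w%:C + s) * Gamma (w%:C - s) / Gamma w%:C ^+ 2 : R[i]^o)].
Proof.
move=> sn nw; have w0 : 0 < w by apply: le_lt_trans nw; rewrite divr_ge0.
have s0 : 0 < complex.Re (w%:C + s).
  by rewrite raddfD /= sn ltr_wpDr// divr_ge0.
have d0 : 0 < complex.Re (w%:C - s) by rewrite raddfB /= sn subr_gt0.
have Gw : Gamma w%:C != 0.
  by rewrite Gamma_real// Re_gt0_neq0//= rgamma_gt0.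
have := Gamma_quot_cvg sn nw; set P := (fun m => _) => P1.
have P0 : \forall M \near \oo, P M != 0.
  have /cvgrPdist_lt/(_ _ ltr01) := P1; apply: filterS => M.
  by apply: contraTneq => ->; rewrite subr0 normr1 ltxx.
have PE M : P M = pochhammer (w%:C + s) M * pochhammer (w%:C - s) M /
    pochhammer w%:C M ^+ 2 * (Gamma (w%:C + s) * Gamma (w%:C - s) / Gamma w%:C ^+ 2).
  rewrite /P !Gamma_add_nat// exprMn invfM; ring.
split.
  have [M _ /(_ M (leqnn _))] := P0.
  by rewrite PE; apply: contraNneq => ->; rewrite !mul0r mulr0.
have L := @cvg_div_complex R _ _ (Gamma (w%:C + s) * Gamma (w%:C - s) / Gamma w%:C ^+ 2)
  (oner_neq0 _) P1.
rewrite divr1 in L.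
apply: cvg_trans L; apply: near_eq_cvg.
move: P0; apply: filterS => M.
rewrite /= PE; set l := _ / Gamma _ ^+ 2.
have p0 := pochhammer_neq0 M s0; have p1 := pochhammer_neq0 M d0.
have p2 : pochhammer w%:C M != 0 by exact: pochhammer_neq0.
rewrite mulf_eq0 negb_or => /andP[_ l0].
by field; rewrite p0 p1 p2 l0.
Qed.

Lemma hypergeo3F2_Gauss (R : realType) (n : nat) (w : R) (s : R[i]) : (0 < n)%N ->
  complex.Re s = n%:R / 2 -> n%:R / 2 < w ->
  hypergeo3F2 s n%:R s (w%:C + s) n%:R 1 =
    Gamma (w%:C + s) * Gamma (w%:C - s) / Gamma w%:C ^+ 2.
Proof.
move=> n0 sn nw; have w0 : 0 < w by apply: le_lt_trans nw; rewrite divr_ge0.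
have [_ L] := pochhammer_quot_Gamma sn nw.
have c0 : 0 < complex.Re (w%:C + s).
  by rewrite raddfD /= sn ltr_wpDr// divr_ge0.
(* Gauss' convergence condition [Re (c - a - b) > 0], which here is [w > n / 2]. *)
have sc : 2 * complex.Re s < complex.Re (w%:C + s) by rewrite raddfD /= sn; lra.
have wE : w%:C + s - s = w%:C by rewrite addrK.
have G := @gauss_sum_cvg R s (w%:C + s) _ c0 sc.
rewrite wE in G; have {}G := G _ L.
rewrite /hypergeo3F2 (_ : series _ = gauss_sum s s (w%:C + s)).
  exact: (cvg_lim (@norm_hausdorff _ _) G).
apply/funext => K; rewrite seriesEord; apply: eq_bigr => k _.
have N0 : pochhammer (n%:R : R[i]) k != 0.
  by apply: pochhammer_neq0; rewrite -[n%:R]add0r Re_add_nat add0r ltr0n.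
rewrite /gauss_term expr1n mul1r [pochhammer _ k * pochhammer _ k * _]mulrAC.
rewrite !invfM [(pochhammer (w%:C + s) k)^-1 / _]mulrC mulrA mulfK//.
by rewrite mulrA.
Qed.

End GaussSummation.

(** * Cancellation of the Gamma factors in [f0] *)

Theorem proposition6p1 (R : realType) (n : nat) (nu lambda : R)
    (hn : (1 <= n)%N) (hnu : n%:R / 2 < nu) :
  f0 n nu lambda =
    `| Gamma (2 * nu%:C - (n%:R - 'i * lambda%:C) / 2) | ^+ 2
      / (Gamma (2 * nu%:C - n%:R) * Gamma (2 * nu%:C)).
Proof.
pose w : R := 2 * nu; pose s : R[i] := (n%:R + 'i * lambda%:C) / 2.
have nw : n%:R < w by rewrite /w -ltr_pdivrMl// mulrC.
have n0 : 0 < n%:R :> R by rewrite ltr0n.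
have sn : complex.Re s = n%:R / 2.
  have -> : s = (n%:R / 2) +i* (lambda / 2).
    rewrite /s -complexiE [RHS]complexE /= !rmorphM /= fmorphV /= !rmorph_nat.
    by field.
  by [].
have nw2 : n%:R / 2 < w by lra.
have [Gd _] := pochhammer_quot_Gamma sn nw2.
have wE : 2 * nu%:C = w%:C by rewrite /w rmorphM /= rmorph_nat.
have NE : n%:R = n%:R%:C :> R[i] by rewrite rmorph_nat.
have w0 : 0 < w by lra.
have Gpos x : 0 < x -> Gamma (x%:C : R[i]) != 0.
  by move=> x0; rewrite Gamma_real// Re_gt0_neq0//= rgamma_gt0.
have GN : Gamma (n%:R : R[i]) != 0 by rewrite NE Gpos.
have Gw := Gpos _ w0.
have wN : w%:C - n%:R = (w - n%:R)%:C by rewrite rmorphB /= NE.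
have wN0 : 0 < w - n%:R by rewrite subr_gt0.
have GwN : Gamma (w%:C - n%:R) != 0 by rewrite wN Gpos.
have wNn : w%:C - n%:R != 0 by rewrite wN Re_gt0_neq0.
(* The second argument of the Beta function; its conjugate [w - s] is the argument of the Gamma
   factor left by Gauss' summation. *)
pose b := w%:C + s - n%:R.
have bJ : conjc b = w%:C - s.
  have sJ : conjc s = n%:R - s.
    rewrite -[LHS](addrK s) [conjc s + s]addrC addcJ sn; congr (_ - _).
    by rewrite rmorphM /= fmorphV /= !rmorph_nat mulrC divfK// pnatr_eq0.
  have wJ : conjc w%:C = w%:C by rewrite /conjc /= oppr0.
  have -> : conjc b = conjc w%:C + conjc s - conjc n%:R by rewrite /b rmorphB rmorphD.
  by rewrite wJ sJ conjc_nat; ring.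
have b0 : 0 < complex.Re b.
  by rewrite /b NE !(raddfB, raddfD) /= sn; lra.
have H1 : ('i * lambda%:C - n%:R) / 2 + w%:C = b by rewrite /b /s; field.
have H2 : w%:C - (n%:R - 'i * lambda%:C) / 2 = b by rewrite /b /s; field.
have H3 : (n%:R + 'i * lambda%:C) / 2 + w%:C = w%:C + s by rewrite addrC.
have H4 : n%:R + b = w%:C + s by rewrite /b addrC subrK.
rewrite /f0 /Beta !wE H1 H2 H3 H4 -/s hypergeo3F2_Gauss//.
(* [Gamma (w - n + 1) = (w - n) Gamma (w - n)] cancels the prefactor [2 nu - n]; then
   [Gamma (w + s)] cancels between the Beta function and the series. *)
rewrite Gamma_rec ?wN// -wN sqr_normc -Gamma_conj// bJ.
by field; rewrite Gw GwN GN wNn Gd.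
Qed.
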